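(* Let $N=1$ and $k\in\mathbb C$. The central character and weights are complete invariants of the irreducible admissible representations of $\mathbb D_k$. More precisely: (i) For all $c,\lambda\in\mathbb C$, there is an irreducible admissible representation $V_k(c,\lambda)$ of $\mathbb D_k$ with central character $c$ and set of weights $\Delta_k(c,\lambda)$. (ii) $V_k(c,\lambda)$ and $V_k(c',\lambda')$ are equivalent if and only if $c'=c$ and $\lambda'\in\Delta_k(c,\lambda)$. (iii) Every irreducible admissible representation of $\mathbb D_k$ is equivalent to some $V_k(c,\lambda)$.
   Context: All vector spaces are complex and $\mathbb N=\{0,1,2,\dots\}$. Let $\mathfrak g=\mathfrak g^J_1$ (the complexified Lie algebra of the real Jacobi group of degree $1$ and rank $1$); it has a basis $\tilde H,\tilde E,\tilde F,\tilde e,\tilde f,\tilde Z$ with $[\tilde H,\tilde E]=2\tilde E$, $[\tilde H,\tilde F]=-2\tilde F$, $[\tilde E,\tilde F]=\tilde H$, $[\tilde H,\tilde e]=\tilde e$, $[\tilde H,\tilde f]=-\tilde f$, $[\tilde E,\tilde e]=0$, $[\tilde E,\tilde f]=-\tilde e$, $[\tilde F,\tilde e]=-\tilde f$, $[\tilde F,\tilde f]=0$, $[\tilde e,\tilde f]=-2\tilde Z$, $\tilde Z$ central. Let $\mathfrak k:=\mathrm{Span}\{\tilde H,\tilde Z\}$. For $k\in\mathbb C$, let $\mathcal I_k$ be the left ideal of $\mathfrak U(\mathfrak g)$ generated by $\tilde H-k$ and $\tilde Z+\tfrac12$, and $\mathbb D_k:=\mathfrak U(\mathfrak g)^{\mathfrak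 k}/(\mathcal I_k\cap\mathfrak U(\mathfrak g)^{\mathfrak k})$, where $\mathfrak U(\mathfrak g)^{\mathfrak k}$ is the commutant of $\mathfrak k$ in the universal enveloping algebra (the ideal is two-sided). Equivalently, $\mathbb D_k=A^{\tilde H}/A^{\tilde H}(\tilde H-k)$, where $A:=\mathfrak U(\mathfrak g)/(\tilde Z+\tfrac12)$ and $A^{\tilde H}$ is the commutant of $\tilde H$. In $A$ set $\tilde E_\nu:=\tilde E+\tfrac12\tilde e^2$, $\tilde F_\nu:=\tilde F-\tfrac12\tilde f^2$, $\tilde H_\nu:=\tilde H+\tilde f\tilde e+\tfrac12$. Expressions in these elements that commute with $\tilde H$ are regarded as elements of $\mathbb D_k$. In $\mathbb D_k$ put $\mathcal E:=\tfrac12(\tilde f\tilde e+\tilde e\tilde f)$ and let $\mathcal C_k:=\tilde H_\nu^2+2\tilde H_\nu+4\tilde F_\nu\tilde E_\nu$, which is central. A representation $V$ of $\mathbb D_k$ is admissible if $\mathcal E$ acts semisimply with finite dimensional eigenspaces. $V$ has central character $c$ if $\mathcal C_k$ acts by the scalar $c$. The $\lambda$-weight space $V_\lambda$ is the $\lambda$-eigenspace of $\mathcal E+k$, and $\lambda$ is a weight of $V$ if $V_\lambda\neq0$. On each coset $\lambda+2\mathbb Z\subset\mathbb C$ use the order $\mu>\mu'$ iff $\mu-\lambda>\mu'-\lambda$ in $2\mathbb Z$, with $-\infty$ and $\infty$ as bottom and top. For $c,\lambda\in\mathbb C$ define $$M^-_k(c,\lambda):=\{-\infty\}\cup\bigl[\{k+\tfrac12,\,k+\tfrac32,\,1\pm\sqrt{c+1}\}\cap(\lambda-2\mathbb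 N)\bigr],\qquad M^+_k(c,\lambda):=\{\infty\}\cup\bigl[\{k-\tfrac12,\,k-\tfrac32,\,-1\pm\sqrt{c+1}\}\cap(\lambda+2\mathbb N)\bigr],$$ $m^-_k(c,\lambda):=\max M^-_k(c,\lambda)$, $m^+_k(c,\lambda):=\min M^+_k(c,\lambda)$, and $\Delta_k(c,\lambda):=\{\mu\in\lambda+2\mathbb Z:m^-_k(c,\lambda)\le\mu\le m^+_k(c,\lambda)\}$. *)

(* Defs.v *)
From HB Require Import structures.
From mathcomp Require Import all_boot all_order all_algebra.
From mathcomp Require Import generic_quotient ring_quotient.
From mathcomp Require Import boolp classical_sets reals.
From mathcomp Require Import complex.
From mathcomp.multinomials Require Import monalg.

Set Implicit Arguments.
Unset Strict Implicit.
Unset Printing Implicit Defensive.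

Import Order.TTheory GRing.Theory Num.Theory.

Local Open Scope ring_scope.
Local Open Scope quotient_scope.
Local Open Scope classical_set_scope.

(* Two-sided ideals of a noncommutative algebra; `ring_quotient` only covers
   proper ideals of commutative rings. An ideal may be improper here, so that
   the quotient is a possibly trivial ring (with its scaling), which `algType`
   excludes. *)

HB.mixin Record isTwoSided (A : pzRingType) (S : A -> bool) := {
  two_sidedMl_subproof : forall a, {in S, forall u, a * u \in S};
  two_sidedMr_subproof : forall a, {in S, forall u, u * a \in S}
}.

#[short(type="twoSidedIdeal")]
HB.structure Definition TwoSided (A : pzRingType) :=
  {S of GRing.ZmodClosed A S & isTwoSided A S}.

Section AlgebraQuotient.
Variables (C : comPzRingType) (A : algType C) (J : twoSidedIdeal A).

Lemma two_sidedMl a u : u \in J -> a * u \in J.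
Proof. exact: two_sidedMl_subproof. Qed.

Lemma two_sidedMr a u : u \in J -> u * a \in J.
Proof. exact: two_sidedMr_subproof. Qed.

Definition algquot := Quotient.quot J.

HB.instance Definition _ := GRing.Zmodule.on algquot.

Definition algquot_pi (x : A) : algquot := \pi_(Quotient.quot J) x.

Lemma algquot_piP x y : reflect (algquot_pi x = algquot_pi y) (x - y \in J).
Proof. by rewrite Quotient.idealrBE; exact: eqP. Qed.

Lemma algquot_pi_surj (q : algquot) : exists x, q = algquot_pi x.
Proof. by exists (repr q); rewrite /algquot_pi reprK. Qed.

Lemma algquot_piB : zmod_morphism algquot_pi.
Proof. by move=> x y; rewrite /algquot_pi raddfB. Qed.

HB.instance Definition _ :=
  GRing.isZmodMorphism.Build A algquot algquot_pi algquot_piB.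

Definition algquot_one : algquot := algquot_pi 1.
(* Locked to keep unification from unfolding the ring operations. *)
Definition algquot_mul : algquot -> algquot -> algquot :=
  locked (fun p q => algquot_pi (repr p * repr q)).
Definition algquot_scale : C -> algquot -> algquot :=
  locked (fun a p => algquot_pi (a *: repr p)).

Lemma repr_algquot_pi x : repr (algquot_pi x) - x \in J.
Proof. by apply/algquot_piP; exact: reprK. Qed.

Lemma algquot_mulE x y :
  algquot_mul (algquot_pi x) (algquot_pi y) = algquot_pi (x * y).
Proof.
rewrite /algquot_mul -lock; apply/algquot_piP; set a := repr _; set b := repr _.
have -> : a * b - x * y = (a - x) * b + x * (b - y).
  by rewrite mulrBl mulrBr addrA subrK.
by apply: rpredD; [apply: two_sidedMr | apply: two_sidedMl];
  exact: repr_algquot_pi.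
Qed.

Lemma algquot_scaleE a x :
  algquot_scale a (algquot_pi x) = algquot_pi (a *: x).
Proof.
rewrite /algquot_scale -lock; apply/algquot_piP; rewrite -scalerBr -mulr_algl.
by apply: two_sidedMl; exact: repr_algquot_pi.
Qed.

Lemma algquot_mulA : associative algquot_mul.
Proof.
move=> p q r; have [x ->] := algquot_pi_surj p.
have [y ->] := algquot_pi_surj q; have [z ->] := algquot_pi_surj r.
by rewrite !algquot_mulE mulrA.
Qed.

Lemma algquot_mul1 : left_id algquot_one algquot_mul.
Proof.
by move=> p; have [x ->] := algquot_pi_surj p; rewrite algquot_mulE mul1r.
Qed.

Lemma algquot_mulr1 : right_id algquot_one algquot_mul.
Proof.
by move=> p; have [x ->] := algquot_pi_surj p; rewrite algquot_mulE mulr1.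
Qed.

Lemma algquot_mulDl : left_distributive algquot_mul +%R.
Proof.
move=> p q r; have [x ->] := algquot_pi_surj p.
have [y ->] := algquot_pi_surj q; have [z ->] := algquot_pi_surj r.
by rewrite -raddfD !algquot_mulE mulrDl raddfD.
Qed.

Lemma algquot_mulDr : right_distributive algquot_mul +%R.
Proof.
move=> p q r; have [x ->] := algquot_pi_surj p.
have [y ->] := algquot_pi_surj q; have [z ->] := algquot_pi_surj r.
by rewrite -raddfD !algquot_mulE mulrDr raddfD.
Qed.

HB.instance Definition _ := GRing.Zmodule_isPzRing.Build algquot
  algquot_mulA algquot_mul1 algquot_mulr1 algquot_mulDl algquot_mulDr.

Lemma algquot_scaleA a b p :
  algquot_scale a (algquot_scale b p) = algquot_scale (a * b) p.
Proof.
by have [x ->] := algquot_pi_surj p; rewrite !algquot_scaleE scalerA.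
Qed.

Lemma algquot_scale1 : left_id 1 algquot_scale.
Proof.
by move=> p; have [x ->] := algquot_pi_surj p; rewrite algquot_scaleE scale1r.
Qed.

Lemma algquot_scaleDr : right_distributive algquot_scale +%R.
Proof.
move=> a p q; have [x ->] := algquot_pi_surj p.
have [y ->] := algquot_pi_surj q.
by rewrite -raddfD !algquot_scaleE scalerDr raddfD.
Qed.

Lemma algquot_scaleDl p : {morph algquot_scale^~ p : a b / a + b}.
Proof.
move=> a b; have [x ->] := algquot_pi_surj p.
by rewrite !algquot_scaleE scalerDl raddfD.
Qed.

HB.instance Definition _ := GRing.Zmodule_isLmodule.Build C algquot
  algquot_scaleA algquot_scale1 algquot_scaleDr algquot_scaleDl.

Lemma algquot_pi_monoid : monoid_morphism algquot_pi.
Proof. by split=> // x y; rewrite -algquot_mulE. Qed.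

HB.instance Definition _ :=
  GRing.isMonoidMorphism.Build A algquot algquot_pi algquot_pi_monoid.

Lemma algquot_pi_scalable : scalable algquot_pi.
Proof. by move=> a x; rewrite -algquot_scaleE. Qed.

HB.instance Definition _ :=
  GRing.isScalable.Build C A algquot *:%R algquot_pi algquot_pi_scalable.

Lemma algquot_scaleAl a (p q : algquot) : a *: (p * q) = a *: p * q.
Proof.
have [x ->] := algquot_pi_surj p; have [y ->] := algquot_pi_surj q.
by rewrite -rmorphM -!linearZ -rmorphM scalerAl.
Qed.

Lemma algquot_scaleAr a (p q : algquot) : a *: (p * q) = p * (a *: q).
Proof.
have [x ->] := algquot_pi_surj p; have [y ->] := algquot_pi_surj q.
by rewrite -rmorphM -!linearZ -rmorphM scalerAr.
Qed.

End AlgebraQuotient.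

Section GeneratedIdeal.
Variables (A : pzRingType) (X : set A).

Definition two_sided (I : set A) : Prop :=
  [/\ I 0, forall x y, I x -> I y -> I (x - y) &
      forall a x, I x -> I (a * x) /\ I (x * a)].

Definition gen_ideal : {pred A} :=
  fun x => `[< forall I, two_sided I -> X `<=` I -> I x >].

Lemma gen_ideal_zmod_closed : zmod_closed gen_ideal.
Proof.
split=> [|x y /asboolP Ix /asboolP Iy]; apply/asboolP => I tI XI.
  by case: tI.
by case: (tI) => _ IB _; apply: IB; [apply: Ix|apply: Iy].
Qed.

HB.instance Definition _ :=
  GRing.isZmodClosed.Build A gen_ideal gen_ideal_zmod_closed.

Lemma gen_idealMl a : {in gen_ideal, forall u, a * u \in gen_ideal}.
Proof.
move=> u /asboolP Iu; apply/asboolP => I tI XI.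
by case: (tI) => _ _ /(_ a u (Iu I tI XI)) [].
Qed.

Lemma gen_idealMr a : {in gen_ideal, forall u, u * a \in gen_ideal}.
Proof.
move=> u /asboolP Iu; apply/asboolP => I tI XI.
by case: (tI) => _ _ /(_ a u (Iu I tI XI)) [].
Qed.

HB.instance Definition _ := isTwoSided.Build A gen_ideal gen_idealMl gen_idealMr.

End GeneratedIdeal.

(* `monalg` only provides this for commutative monoids. *)
Lemma malg_scaleAr (C : comNzRingType) (K : monomType) (a : C)
    (x y : {malg C[K]}) :
  a *: (x * y) = x * (a *: y).
Proof.
have gcC (z : {malg C[K]}) : z * a%:MP = a%:MP * z.
  rewrite [in LHS](monalgE z) [in RHS](monalgE z) mulr_suml mulr_sumr.
  apply: eq_bigr => i _; rewrite !malgM_def !fgmulUU.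
  by rewrite mulm1 mul1m mulrC.
by rewrite -!mul_malgC mulrA -gcC mulrA.
Qed.

(* The free algebra, with the product of `monalg` locked as above. *)
Section FreeAlgebra.
Variables (C : comNzRingType) (I : choiceType).
Local Notation malgI := {malg C[{fmonom I}]}.

Definition free_alg := malgI.
HB.instance Definition _ := GRing.Lmodule.on free_alg.

Definition free_gen (i : I) : free_alg := << fmu i >>.

Definition free_mul : free_alg -> free_alg -> free_alg :=
  locked (fun x y : malgI => x * y).

Lemma free_mulE (x y : malgI) : free_mul x y = x * y.
Proof. by rewrite /free_mul -lock. Qed.

Lemma free_mulA : associative free_mul.
Proof. by move=> x y z; rewrite !free_mulE mulrA. Qed.

Lemma free_mul1 : left_id (1 : malgI) free_mul.
Proof. by move=> x; rewrite free_mulE mul1r. Qed.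

Lemma free_mulr1 : right_id (1 : malgI) free_mul.
Proof. by move=> x; rewrite free_mulE mulr1. Qed.

Lemma free_mulDl : left_distributive free_mul +%R.
Proof. by move=> x y z; rewrite !free_mulE mulrDl. Qed.

Lemma free_mulDr : right_distributive free_mul +%R.
Proof. by move=> x y z; rewrite !free_mulE mulrDr. Qed.

Lemma free_oner_neq0 : (1 : malgI) != 0.
Proof. exact: oner_neq0. Qed.

HB.instance Definition _ := GRing.Zmodule_isNzRing.Build free_alg
  free_mulA free_mul1 free_mulr1 free_mulDl free_mulDr free_oner_neq0.

Lemma free_scaleAl a (x y : free_alg) :
  a *: free_mul x y = free_mul (a *: x) y.
Proof.
by rewrite !free_mulE; exact: (scalerAl a (x : malgI) y).
Qed.

HB.instance Definition _ :=
  GRing.Lmodule_isLalgebra.Build C free_alg free_scaleAl.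

Lemma free_scaleAr a (x y : free_alg) :
  a *: free_mul x y = free_mul x (a *: y).
Proof.
by rewrite !free_mulE; exact: malg_scaleAr.
Qed.

HB.instance Definition _ :=
  GRing.Lalgebra_isAlgebra.Build C free_alg free_scaleAr.

Definition free_aug (x : free_alg) : C := mcoeff (mone : {fmonom I}) x.

Lemma free_aug_zmod : zmod_morphism free_aug.
Proof. by move=> x y; rewrite /free_aug raddfB. Qed.

Lemma free_aug_monoid : monoid_morphism free_aug.
Proof.
split=> [|x y]; first by rewrite /free_aug mcoeff1 eqxx.
pose aug : {rmorphism malgI -> C} := mcoeff (mone : {fmonom I}).
exact: etrans (congr1 aug (free_mulE x y)) (rmorphM aug _ _).
Qed.

HB.instance Definition _ :=
  GRing.isZmodMorphism.Build free_alg C free_aug free_aug_zmod.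
HB.instance Definition _ :=
  GRing.isMonoidMorphism.Build free_alg C free_aug free_aug_monoid.

Lemma free_augZ a x : free_aug (a *: x) = a * free_aug x.
Proof. exact: mcoeffZ. Qed.

Lemma free_aug_gen i : free_aug (free_gen i) = 0.
Proof.
rewrite /free_aug mcoeffU1 [_ == _](_ : _ = false) //.
by apply/negbTE/eqP => /(congr1 (@fdeg _)); rewrite fdegU fdeg1.
Qed.

End FreeAlgebra.

Variant jgen := tH | tE | tF | te | tf | tZ.

Definition jgen_enc (x : jgen) : 'I_6 :=
  inord (match x with tH => 0 | tE => 1 | tF => 2 | te => 3 | tf => 4 | tZ => 5
         end).

Definition jgen_dec (i : 'I_6) : jgen :=
  match val i with
  | 0 => tH | 1 => tE | 2 => tF | 3 => te | 4 => tf | _ => tZ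
  end.

Lemma jgen_encK : cancel jgen_enc jgen_dec.
Proof. by case; rewrite /jgen_dec /= inordK. Qed.

HB.instance Definition _ := Equality.copy jgen (can_type jgen_encK).
HB.instance Definition _ := Choice.copy jgen (can_type jgen_encK).
HB.instance Definition _ := Countable.copy jgen (can_type jgen_encK).
HB.instance Definition _ := Finite.copy jgen (can_type jgen_encK).

Section JacobiAlgebra.
Variable C : numClosedFieldType.

Definition jacobi := {ffun jgen -> C^o}.
HB.instance Definition _ := GRing.Lmodule.on jacobi.

Definition jbasis (i : jgen) : jacobi := [ffun j => (j == i)%:R].

(* The bracket of basis vectors, one order per unordered pair; `jbracket` is
   its antisymmetric bilinear extension. *)
Definition jstruct (i j : jgen) : jacobi :=
  match i, j with
  | tH, tE => 2 *: jbasis tE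
  | tH, tF => - (2 *: jbasis tF)
  | tE, tF => jbasis tH
  | tH, te => jbasis te
  | tH, tf => - jbasis tf
  | tE, tf => - jbasis te
  | tF, te => - jbasis tf
  | te, tf => - (2 *: jbasis tZ)
  | _, _ => 0
  end.

Definition jbracket (x y : jacobi) : jacobi :=
  \sum_i \sum_j (x i * y j) *: (jstruct i j - jstruct j i).

(* The tensor algebra of `jacobi` is the free algebra on its basis. *)
Local Notation jtensor := (free_alg C jgen).

Definition jtensor_inj : jacobi -> jtensor :=
  locked (fun x => \sum_i x i *: free_gen C i).

Lemma jtensor_injE x : jtensor_inj x = \sum_i x i *: free_gen C i.
Proof. by rewrite /jtensor_inj -lock. Qed.

Definition jrelations : set jtensor :=
  [set r | exists x y, r = jtensor_inj x * jtensor_inj y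
                           - jtensor_inj y * jtensor_inj x
                           - jtensor_inj (jbracket x y)].

Definition jrel_ideal : twoSidedIdeal jtensor := gen_ideal jrelations.
Definition jU := @algquot C jtensor jrel_ideal.
HB.instance Definition _ := GRing.PzRing.on jU.
HB.instance Definition _ := GRing.Lmodule.on jU.

Lemma jrelations_one : (1 : jtensor) \notin gen_ideal jrelations.
Proof.
pose aug : {rmorphism jtensor -> C} := @free_aug C jgen.
have inj0 x : aug (jtensor_inj x) = 0.
  rewrite jtensor_injE (rmorph_sum aug) big1 // => i _.
  by rewrite /= free_augZ free_aug_gen mulr0.
apply/negP => /asboolP /(_ [set u | aug u = 0]) H.
suff /eqP : aug 1 = 0 by rewrite rmorph1 oner_eq0.
apply: H => [|_ [x [y ->]]]; rewrite /mkset.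
  split=> [|u v u0 v0|a u u0]; first exact: rmorph0.
    by rewrite rmorphB u0 v0 subr0.
  by split; rewrite (rmorphM aug) u0 ?mulr0 ?mul0r.
by rewrite rmorphB inj0 subr0 rmorphB !rmorphM !inj0 mulr0 subr0.
Qed.

Lemma jU_one_neq0 : (1 : jU) != 0.
Proof.
apply/eqP => e; have {e} : algquot_pi jrel_ideal 1 = algquot_pi jrel_ideal 0.
  by rewrite raddf0; exact: e.
by move/(introT (algquot_piP _ _ _)); rewrite subr0; apply/negP/jrelations_one.
Qed.

HB.instance Definition _ := GRing.PzSemiRing_isNonZero.Build jU jU_one_neq0.
HB.instance Definition _ := GRing.Lmodule_isLalgebra.Build C jU
  (@algquot_scaleAl C jtensor jrel_ideal).
HB.instance Definition _ := GRing.Lalgebra_isAlgebra.Build C jU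
  (@algquot_scaleAr C jtensor jrel_ideal).

Definition jinj (x : jacobi) : jU := algquot_pi jrel_ideal (jtensor_inj x).

Lemma jtensor_inj_linear : linear jtensor_inj.
Proof.
move=> a x y; rewrite !jtensor_injE scaler_sumr -big_split /=.
by apply: eq_bigr => i _; rewrite !ffunE scalerDl scalerA.
Qed.

Lemma jinj_linear : linear jinj.
Proof. by move=> a x y; rewrite /jinj jtensor_inj_linear raddfD -linearZ. Qed.

HB.instance Definition _ := GRing.isLinear.Build C jacobi jU *:%R jinj jinj_linear.

Lemma jinj_bracket x y : jinj x * jinj y - jinj y * jinj x = jinj (jbracket x y).
Proof.
rewrite /jinj; set X := jtensor_inj x; set Y := jtensor_inj y.
rewrite -(rmorphM (algquot_pi jrel_ideal) X Y).
rewrite -(rmorphM (algquot_pi jrel_ideal) Y X).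
rewrite -(raddfB (algquot_pi jrel_ideal)).
apply/algquot_piP/asboolP => I _; apply.
by exists x, y.
Qed.

Lemma jbracket_basis i j :
  jbracket (jbasis i) (jbasis j) = jstruct i j - jstruct j i.
Proof.
rewrite /jbracket (bigD1 i) //= (bigD1 j) //= !ffunE !eqxx mulr1 scale1r.
rewrite !big1 ?addr0 // => [k /negbTE ki|k /negbTE kj].
  by rewrite big1 // => l _; rewrite !ffunE ki mul0r scale0r.
by rewrite !ffunE kj mulr0 scale0r.
Qed.

Definition jgenU (i : jgen) : jU := jinj (jbasis i).

Local Notation uH := (jgenU tH).
Local Notation uE := (jgenU tE).
Local Notation uF := (jgenU tF).
Local Notation ue := (jgenU te).
Local Notation uf := (jgenU tf).
Local Notation uZ := (jgenU tZ).

Lemma jgenUZ i : GRing.comm uZ (jgenU i).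
Proof.
apply/subr0_eq; rewrite jinj_bracket jbracket_basis.
by case: i; rewrite subrr linear0.
Qed.

Definition jk : set jacobi :=
  [set x | exists a b : C, x = a *: jbasis tH + b *: jbasis tZ].

Definition jcommutant : {pred jU} :=
  fun u => `[< forall x, jk x -> jinj x * u = u * jinj x >].

Lemma jcommutantP u :
  reflect (uH * u = u * uH /\ uZ * u = u * uZ) (u \in jcommutant).
Proof.
apply: (iffP (asboolP _)) => [uk|[uH_ uZ_] _ [a [b ->]]].
  split; apply: uk; [exists 1, 0|exists 0, 1];
  by rewrite scale1r scale0r ?addr0 ?add0r.
have -> : jinj (a *: jbasis tH + b *: jbasis tZ) = a *: uH + b *: uZ.
  by rewrite jinj_linear (linearZ_LR jinj).
move: uH uZ uH_ uZ_ => h z uh uz.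
by rewrite mulrDl mulrDr -!scalerAl -!scalerAr uh uz.
Qed.

Lemma jcommutant_subalg : subalg_closed jcommutant.
Proof.
split=> [|a u v /asboolP uk /asboolP vk|u v /asboolP uk /asboolP vk];
  apply/asboolP => x xk.
- by rewrite mulr1 mul1r.
- by rewrite mulrDr mulrDl -scalerAr -scalerAl uk // vk.
- by rewrite mulrA uk // -mulrA vk // mulrA.
Qed.

HB.instance Definition _ :=
  GRing.isSubalgClosed.Build C jU jcommutant jcommutant_subalg.

Record jUk := JUk { jUk_val : jU; _ : jUk_val \in jcommutant }.
HB.instance Definition _ := [isSub for jUk_val].
HB.instance Definition _ := [Choice of jUk by <:].
HB.instance Definition _ := [SubChoice_isSubAlgebra of jUk by <:].

Lemma jUk_val0 : jUk_val 0 = 0. Proof. exact: (rmorph0 val). Qed.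
Lemma jUk_valB u v : jUk_val (u - v) = jUk_val u - jUk_val v.
Proof. exact: (rmorphB val). Qed.
Lemma jUk_valM u v : jUk_val (u * v) = jUk_val u * jUk_val v.
Proof. exact: (rmorphM val). Qed.

Section LeftIdeal.
Variable k : C.

Definition jleft_ideal : set jU :=
  [set u | exists a b, u = a * (uH - k%:A) + b * (uZ + 2^-1%:A)].

Definition jDideal : {pred jUk} := fun u => `[< jleft_ideal (jUk_val u) >].

Lemma jDideal_zmod_closed : zmod_closed jDideal.
Proof.
split=> [|u v /asboolP [a [b uE_]] /asboolP [c [d vE]]]; apply/asboolP.
  by exists 0, 0; rewrite !mul0r addr0 jUk_val0.
by exists (a - c), (b - d); rewrite jUk_valB uE_ vE !mulrBl opprD addrACA.
Qed.

HB.instance Definition _ :=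
  GRing.isZmodClosed.Build jUk jDideal jDideal_zmod_closed.

Lemma jDidealMl a : {in jDideal, forall u, a * u \in jDideal}.
Proof.
move=> u /asboolP [b [c uE_]]; apply/asboolP; exists (jUk_val a * b), (jUk_val a * c).
by rewrite jUk_valM uE_ mulrDr !mulrA.
Qed.

Lemma jDidealMr a : {in jDideal, forall u, u * a \in jDideal}.
Proof.
move=> u /asboolP [b [c uE_]]; apply/asboolP; exists (b * jUk_val a), (c * jUk_val a).
have [aH aZ] := jcommutantP (jUk_val a) (valP a).
rewrite jUk_valM uE_ mulrDl -!mulrA; congr (_ * _ + _ * _).
  by rewrite mulrBl mulrBr aH mulr_algl mulr_algr.
by rewrite mulrDl mulrDr aZ mulr_algl mulr_algr.
Qed.

HB.instance Definition _ := isTwoSided.Build jUk jDideal jDidealMl jDidealMr.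

Definition jD := @algquot C jUk jDideal.
HB.instance Definition _ := GRing.PzRing.on jD.
HB.instance Definition _ := GRing.Lmodule.on jD.

End LeftIdeal.

Definition jwt (n : C) (u : jU) : Prop := uH * u = u * uH + n *: u.

Lemma jwtD n u v : jwt n u -> jwt n v -> jwt n (u + v).
Proof. by rewrite /jwt => un vn; rewrite mulrDr un vn mulrDl scalerDr addrACA. Qed.

Lemma jwtZ n a u : jwt n u -> jwt n (a *: u).
Proof.
rewrite /jwt => un; rewrite -scalerAr un scalerDr scalerAl.
by rewrite !scalerA mulrC.
Qed.

Lemma jwtM n m u v : jwt n u -> jwt m v -> jwt (n + m) (u * v).
Proof.
rewrite /jwt => un vm; rewrite mulrA un mulrDl -mulrA vm mulrDr mulrA -addrA.
by rewrite -scalerAl -scalerAr -scalerDl addrC [m + n]addrC addrC.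
Qed.

Lemma jwtX2 n u : jwt n u -> jwt (n + n) (u ^+ 2).
Proof. by move=> un; rewrite expr2; exact: jwtM. Qed.

Lemma jwt1 a : jwt 0 a%:A.
Proof. by rewrite /jwt mulr_algl mulr_algr scale0r addr0. Qed.

Lemma jwt_gen i n : jstruct tH i - jstruct i tH = n *: jbasis i ->
  jwt n (jgenU i).
Proof.
rewrite /jwt => e; suff <- : uH * jgenU i - jgenU i * uH = n *: jgenU i.
  by rewrite addrC subrK.
by rewrite jinj_bracket jbracket_basis e (linearZ_LR jinj).
Qed.

Lemma jwtH : jwt 0 uH.
Proof. by apply: jwt_gen; rewrite subrr scale0r. Qed.
Lemma jwtE : jwt 2 uE.
Proof. by apply: jwt_gen; rewrite subr0. Qed.
Lemma jwtF : jwt (- 2) uF.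
Proof. by apply: jwt_gen; rewrite subr0 scaleNr. Qed.
Lemma jwte : jwt 1 ue.
Proof. by apply: jwt_gen; rewrite subr0 scale1r. Qed.
Lemma jwtf : jwt (- 1) uf.
Proof. by apply: jwt_gen; rewrite subr0 scaleN1r. Qed.

(* Lifts to U(g) of elements of U(g)/(Z + 1/2); the lifts do not matter for
   their classes in `jD`, as Z + 1/2 lies in `jleft_ideal`. *)
Definition jEnu : jU := uE + 2^-1 *: ue ^+ 2.
Definition jFnu : jU := uF - 2^-1 *: uf ^+ 2.
Definition jHnu : jU := uH + uf * ue + 2^-1%:A.
Definition jcalE : jU := 2^-1 *: (uf * ue + ue * uf).
Definition jcasimir : jU := jHnu ^+ 2 + 2 *: jHnu + 4 *: (jFnu * jEnu).

Lemma jcommZ_scale a u : GRing.comm uZ u -> GRing.comm uZ (a *: u).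
Proof. by rewrite /GRing.comm => e; rewrite -scalerAr e scalerAl. Qed.

Lemma jcommutant_wt u : jwt 0 u -> GRing.comm uZ u -> u \in jcommutant.
Proof.
by move=> u0 uz; apply/jcommutantP; split=> //; rewrite u0 scale0r addr0.
Qed.

Lemma jwtHnu : jwt 0 jHnu.
Proof.
apply: jwtD (jwt1 _); apply: jwtD jwtH _.
by rewrite -[0](addNr 1); exact: jwtM jwtf jwte.
Qed.

Lemma jcommHnu : GRing.comm uZ jHnu.
Proof.
apply: commrD; last by apply: jcommZ_scale; exact: commr1.
by apply: commrD; [|apply: commrM]; exact: jgenUZ.
Qed.

Lemma jcalE_commutant : jcalE \in jcommutant.
Proof.
apply: jcommutant_wt.
  apply: jwtZ; apply: jwtD.
    by rewrite -[0](addNr 1); exact: jwtM jwtf jwte.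
  by rewrite -[0](subrr 1); exact: jwtM jwte jwtf.
by apply: jcommZ_scale; apply: commrD; apply: commrM; exact: jgenUZ.
Qed.

Lemma jcasimir_commutant : jcasimir \in jcommutant.
Proof.
have e2 : 1 + 1 = 2 :> C by [].
apply: jcommutant_wt.
  apply: jwtD; first apply: jwtD.
  - by rewrite -[0](addr0 0); exact: jwtX2 jwtHnu.
  - by apply: jwtZ; exact: jwtHnu.
  apply: jwtZ; rewrite -[0](addNr 2); apply: jwtM.
    apply: jwtD jwtF _; rewrite -scaleNr; apply: jwtZ.
    by rewrite -e2 opprD; exact: jwtX2 jwtf.
  by apply: jwtD jwtE _; apply: jwtZ; rewrite -e2; exact: jwtX2 jwte.
apply: commrD; first apply: commrD.
- by apply: commrX; exact: jcommHnu.
- by apply: jcommZ_scale; exact: jcommHnu.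
apply: jcommZ_scale; apply: commrM.
  by apply: commrB; [|apply: jcommZ_scale; apply: commrX]; exact: jgenUZ.
by apply: commrD; [|apply: jcommZ_scale; apply: commrX]; exact: jgenUZ.
Qed.

Variable k : C.

Definition jD_calE : jD k :=
  algquot_pi (jDideal k) (JUk jcalE_commutant).
Definition jD_casimir : jD k :=
  algquot_pi (jDideal k) (JUk jcasimir_commutant).

Definition jD_scalar (a : C) : jD k := a *: (1 : jD k).

End JacobiAlgebra.

(* A representation of `jD C k` is a left `jD C k`-module; its complex vector
   space structure is restriction of scalars along `jD_scalar`. *)
Section Representations.
Variables (C : numClosedFieldType) (k : C).
Implicit Types V W : lmodType (jD k).

Definition irreducible V : Prop :=
  (exists v : V, v != 0) /\
  forall S : {pred V}, submod_closed S ->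
    (forall v, v \in S -> v = 0) \/ (forall v, v \in S).

Definition equivalent V W : Prop := exists f : {linear V -> W}, bijective f.

Definition eigen_space V (x : jD k) (a : C) : set V :=
  [set v | x *: v = jD_scalar k a *: v].

(* Diagonalizability: a sum of eigenlines is automatically a direct sum of
   some of them. *)
Definition acts_semisimply V (x : jD k) : Prop :=
  forall v : V, exists s : seq V,
    {in s, forall w, exists a, eigen_space x a w} /\ v = \sum_(w <- s) w.

Definition finite_dimensional V (E : set V) : Prop :=
  exists (n : nat) (e : 'I_n -> V), (forall i, E (e i)) /\
    forall v, E v -> exists a : 'I_n -> C, v = \sum_i jD_scalar k (a i) *: e i.

Definition admissible V : Prop :=
  acts_semisimply V (jD_calE k) /\
  forall a, finite_dimensional (eigen_space (V := V) (jD_calE k) a).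

Definition has_central_character V (c : C) : Prop :=
  forall v : V, jD_casimir k *: v = jD_scalar k c *: v.

Definition weight_space V (l : C) : set V :=
  eigen_space (jD_calE k + jD_scalar k k) l.

Definition weights V : set C :=
  [set l | exists2 v : V, weight_space l v & v != 0].

End Representations.

(* Cosets of 2Z in C, with a bottom and a top; `ext_le` leaves
   points of different cosets incomparable. *)
Variant ext (C : Type) := ninfty | fin of C | pinfty.
Arguments ninfty {C}.
Arguments pinfty {C}.

HB.instance Definition _ (C : Type) := gen_eqMixin (ext C).
HB.instance Definition _ (C : Type) := gen_choiceMixin (ext C).

Section WeightSets.
Variables (C : numClosedFieldType) (k : C).

Definition ext_le (x y : ext C) : Prop :=
  match x, y with
  | ninfty, _ | _, pinfty => True
  | fin a, fin b => exists n : nat, b = a + 2 * n%:R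
  | _, _ => False
  end.

Definition ext_max (M : set (ext C)) : ext C :=
  xget ninfty [set m | M m /\ forall m', M m' -> ext_le m' m].

Definition ext_min (M : set (ext C)) : ext C :=
  xget pinfty [set m | M m /\ forall m', M m' -> ext_le m m'].

Definition Mminus (c l : C) : set (ext C) :=
  [set ninfty] `|`
  [set fin m | m in
     [set k + 2^-1; k + 3 / 2; 1 + sqrtC (c + 1); 1 - sqrtC (c + 1)]
     `&` [set l - 2 * n%:R | n in [set: nat]]].

Definition Mplus (c l : C) : set (ext C) :=
  [set pinfty] `|`
  [set fin m | m in
     [set k - 2^-1; k - 3 / 2; - 1 + sqrtC (c + 1); - 1 - sqrtC (c + 1)]
     `&` [set l + 2 * n%:R | n in [set: nat]]].

Definition mminus (c l : C) : ext C := ext_max (Mminus c l).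
Definition mplus (c l : C) : ext C := ext_min (Mplus c l).

Definition Delta (c l : C) : set C :=
  [set m | [/\ exists n : int, m = l + 2 * n%:~R,
               ext_le (mminus c l) (fin m) & ext_le (fin m) (mplus c l)]].

End WeightSets.

(* Main.v *)
Require Import Defs.
From HB Require Import structures.
From mathcomp Require Import all_boot all_order all_algebra.
From mathcomp Require Import boolp classical_sets reals complex.
From mathcomp Require Import functions.
From mathcomp Require Import ring zify.
From mathcomp.multinomials Require Import monalg.

Set Implicit Arguments.
Unset Strict Implicit.
Unset Printing Implicit Defensive.

Import Order.TTheory GRing.Theory Num.Theory.
Local Open Scope ring_scope.
Local Open Scope classical_set_scope.

(** The proof rests on one change of generators.  In A = U(g)/(Z + 1/2) the
elements e, f satisfy [e, f] = 1, and E_nu = E + e^2/2, F_nu = F - f^2/2,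
H_nu = H + f e + 1/2 commute with e and f and form an sl2-triple: A is a
Weyl algebra times U(sl2) (lemmas [split_of_jacobi], [jacobi_of_split]).  The
commutant of H is then easy to describe.  As a left module over itself A is
spanned by products (power of f or of e) * (power of E_nu or of F_nu) *
(polynomial in H, cal E and the Casimir), see [jA_spanned]; such a product has
H-weight 0 only when it is, up to the last factor, a power of the raising
element f^2 E_nu or of the lowering element e^2 F_nu ([cls_spanned]).

So let v be a vector of weight l and Casimir value c in a D_k-module.  The
polynomial factors act on v by scalars, hence D_k v is spanned by the vectors
t_q v of weight l + 2 q, where t_q is the q-th power of the raising element,
or of the lowering one when q < 0; each weight space of D_k v has dimension
at most one ([cyclic_sum], [cyclic_weight_line]).

Uniqueness.  Let W, W' be irreducible with the same Casimir value and common
weight l, with weight vectors v, v'.  In the submodule of W * W' generated by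
(v, v') the weight space of weight l is the line through (v, v'), so it does
not contain (0, v'); by irreducibility of W' an element of D_k killing v kills
v' ([annihilator_sub]).  By symmetry d v |-> d v' is an isomorphism
([irreducible_equivalent]).  A central character exists because the Casimir
element is central and preserves a nonzero finite-dimensional eigenspace
([irreducible_central_character]).

Existence.  The Weyl algebra acts on x^b, b in a coset of Z, and sl2 acts on
a module with weights in l + 2 Z and Casimir value c.  On the tensor product
the k-weight space of H is a D_k-module with a basis indexed by l + 2 Z.  In
both factors the raising operators f and E_nu are made to vanish exactly where
the composite with the opposite operator does (the [gate] below).  With this
choice the module breaks into a direct sum of irreducible ones, so that the
submodule generated by the basis vector of weight l is irreducible
([cyclic_irreducible]); its weights are those reached from l without crossing
a zero of the lowering coefficient, and these zeros are the numbers that bound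
the interval Delta ([DeltaE]). *)

(** * Commutators in an algebra *)

Section Commutators.
Variables (C : comNzRingType) (A : algType C).
Implicit Types (x y z : A) (a : C).

Definition lie x y : A := x * y - y * x.

Lemma lieC x y : lie x y = - lie y x.
Proof. by rewrite /lie opprB. Qed.

Lemma lieE x y : x * y = y * x + lie x y.
Proof. by rewrite /lie addrC subrK. Qed.

Lemma lie_comm x y : GRing.comm x y -> lie x y = 0.
Proof. by rewrite /lie => ->; rewrite subrr. Qed.

Lemma comm_lie x y : lie x y = 0 -> GRing.comm x y.
Proof. exact: subr0_eq. Qed.

Lemma liexx x : lie x x = 0.
Proof. by rewrite /lie subrr. Qed.

Lemma lieDl x y z : lie (x + y) z = lie x z + lie y z.
Proof. by rewrite /lie mulrDl mulrDr opprD addrACA. Qed.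

Lemma lieDr x y z : lie x (y + z) = lie x y + lie x z.
Proof. by rewrite /lie mulrDl mulrDr opprD addrACA. Qed.

Lemma lieNl x y : lie (- x) y = - lie x y.
Proof. by rewrite /lie mulNr mulrN opprB opprK addrC. Qed.

Lemma lieNr x y : lie x (- y) = - lie x y.
Proof. by rewrite lieC lieNl -lieC. Qed.

Lemma lieZl a x y : lie (a *: x) y = a *: lie x y.
Proof. by rewrite /lie -scalerAl -scalerAr scalerBr. Qed.

Lemma lieZr a x y : lie x (a *: y) = a *: lie x y.
Proof. by rewrite /lie -scalerAl -scalerAr scalerBr. Qed.

Lemma lie1r x : lie x 1 = 0.
Proof. by rewrite /lie mulr1 mul1r subrr. Qed.

Lemma lie1l x : lie 1 x = 0.
Proof. by rewrite lieC lie1r oppr0. Qed.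

Lemma lieMl x y z : lie (x * y) z = x * lie y z + lie x z * y.
Proof. by rewrite /lie mulrBl mulrBr !mulrA addrA subrK. Qed.

Lemma lieMr x y z : lie x (y * z) = lie x y * z + y * lie x z.
Proof. by rewrite /lie mulrBl mulrBr !mulrA addrA subrK. Qed.

End Commutators.

(** * The Weyl algebra splits off *)

Section Splitting.
Variables (C : numClosedFieldType) (A : algType C).
Implicit Types (H E F e f : A).

(** The brackets of the Jacobi algebra with Z specialized to -1/2. *)
Record jacobi_rels H E F e f : Prop := JacobiRels {
  jac_HE : lie H E = 2 *: E;
  jac_HF : lie H F = - (2 *: F);
  jac_EF : lie E F = H;
  jac_He : lie H e = e;
  jac_Hf : lie H f = - f;
  jac_Ee : lie E e = 0;
  jac_Ef : lie E f = - e;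
  jac_Fe : lie F e = - f;
  jac_Ff : lie F f = 0;
  jac_ef : lie e f = 1 }.

Record weyl_sl2_rels e f E F H : Prop := WeylSl2Rels {
  ws_ef : lie e f = 1;
  ws_Ee : lie E e = 0;
  ws_Ef : lie E f = 0;
  ws_Fe : lie F e = 0;
  ws_Ff : lie F f = 0;
  ws_He : lie H e = 0;
  ws_Hf : lie H f = 0;
  ws_HE : lie H E = 2 *: E;
  ws_HF : lie H F = - (2 *: F);
  ws_EF : lie E F = H }.

Lemma half_double (V : lmodType C) (x : V) : 2^-1 *: (x + x) = x.
Proof. by rewrite -mulr2n -scaler_nat scalerA mulVf ?scale1r ?pnatr_eq0. Qed.

Lemma double_half (V : lmodType C) (x : V) : 2 *: (2^-1 *: x) = x.
Proof. by rewrite scalerA mulfV ?scale1r ?pnatr_eq0. Qed.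

Definition lie_simpE := (lieDl, lieDr, lieNl, lieNr, lieZl, lieZr, lie1r, lie1l,
  lieMl, lieMr, expr2, liexx).
Definition ring_simpE := (mul0r, mulr0, mul1r, mulr1, oppr0, addr0, add0r,
  scaler0, mulrN, mulNr, scalerN, (@opprK A), opprD).

(** Subtracting the oscillator representation, in which E, F and H act by the
quadratic expressions -e^2/2, f^2/2 and -f e - 1/2, leaves operators that
commute with e and f. *)
Lemma split_of_jacobi H E F e f : jacobi_rels H E F e f ->
  weyl_sl2_rels e f (E + 2^-1 *: e ^+ 2) (F - 2^-1 *: f ^+ 2)
    (H + f * e + 2^-1%:A).
Proof.
case=> HE HF EF He Hf Ee Ef Fe Ff ef.
have fe : lie f e = -1 by rewrite lieC ef.
have eH : lie e H = - e by rewrite lieC He.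
have eF : lie e F = f by rewrite lieC Fe opprK.
have fF : lie f F = 0 by rewrite lieC Ff oppr0.
have eE : lie e E = 0 by rewrite lieC Ee oppr0.
have fE : lie f E = e by rewrite lieC Ef opprK.
split; rewrite ?lie_simpE ?(ef, Ee, Ef, Fe, Ff, He, Hf, HE, HF, EF, fe, eH, eF,
  fF, eE, fE) ?ring_simpE ?half_double ?addNr ?subrr //.
- by rewrite -opprD mulNr mulrDl scalerN half_double subrr addr0 scalerDr
    double_half.
- by rewrite mulrDr half_double subrr addr0 scalerBr double_half opprB opprK
    addrC.
- have -> : e * (f + f) + (f + f) * e = (e * f + f * e) + (e * f + f * e).
    by rewrite mulrDr mulrDl addrACA.
  rewrite half_double subrr addr0 -opprD scalerN opprK (lieE e f) ef addrAC.
  by rewrite scalerDr half_double addrA.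
Qed.

Lemma jacobi_of_split e f E F H : weyl_sl2_rels e f E F H ->
  jacobi_rels (H - f * e - 2^-1%:A) (E - 2^-1 *: e ^+ 2)
    (F + 2^-1 *: f ^+ 2) e f.
Proof.
case=> ef Ee Ef Fe Ff He Hf HE HF EF.
have fe : lie f e = -1 by rewrite lieC ef.
have eH : lie e H = 0 by rewrite lieC He oppr0.
have fH : lie f H = 0 by rewrite lieC Hf oppr0.
have eF : lie e F = 0 by rewrite lieC Fe oppr0.
have fF : lie f F = 0 by rewrite lieC Ff oppr0.
have eE : lie e E = 0 by rewrite lieC Ee oppr0.
have fE : lie f E = 0 by rewrite lieC Ef oppr0.
split; rewrite ?lie_simpE
  ?(ef, Ee, Ef, Fe, Ff, He, Hf, HE, HF, EF, fe, eH, eF, fF, eE, fE, fH)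
  ?ring_simpE ?half_double ?addNr ?subrr //.
- by rewrite -opprD mulNr mulrDl scalerN half_double scalerBr double_half.
- by rewrite mulrDr half_double scalerDr double_half opprD.
- have -> : e * (f + f) + (f + f) * e = (e * f + f * e) + (e * f + f * e).
    by rewrite mulrDr mulrDl addrACA.
  by rewrite half_double (lieE e f) ef addrAC scalerDr half_double opprD addrA.
Qed.

(** Identities between integer polynomials in one element of a noncommutative
algebra can be proved by [ring] in the commutative ring of polynomials. *)
Lemma horner_identity (x : A) (p q : {poly C}) y z :
  p = q -> horner_alg x p = y -> horner_alg x q = z -> y = z.
Proof. by move=> -> <-. Qed.

Section Consequences.
Variables (e f E F H : A).
Hypothesis ws : weyl_sl2_rels e f E F H.

Lemma ws_comm :
  [/\ E * e = e * E, E * f = f * E, F * e = e * F & F * f = f * F] /\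
  (H * e = e * H /\ H * f = f * H).
Proof. by case: ws => *; split; split; apply: comm_lie. Qed.

Lemma ws_e_fe : f * e * e = e * (f * e - 1).
Proof.
by rewrite mulrBr mulr1 mulrA (lieE e f) (ws_ef ws) mulrDl mul1r addrK.
Qed.

Lemma ws_f_fe : f * e * f = f * (f * e + 1).
Proof. by rewrite -mulrA (lieE e f) (ws_ef ws). Qed.

Lemma ws_H_E : H * E = E * (H + 2).
Proof.
by rewrite lieE (ws_HE ws) mulrDr; congr (_ + _); rewrite mulr_natr scaler_nat.
Qed.

Lemma ws_H_F : H * F = F * (H - 2).
Proof.
by rewrite lieE (ws_HF ws) mulrBr; congr (_ - _); rewrite mulr_natr scaler_nat.
Qed.

(** Multiplying a power of one generator by its opposite generator lowers the
power by one and leaves a factor on the right that commutes with the grading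
element; the next four lemmas record that factor. *)
Lemma ws_e_fX n : e * f ^+ n.+1 = f ^+ n * (f * e + n.+1%:R).
Proof.
elim: n => [|n IH]; first by rewrite expr1 expr0 mul1r lieE (ws_ef ws).
rewrite exprSr mulrA IH -mulrA mulrDl ws_f_fe -(commr_nat f) -mulrDr.
by rewrite mulrA -exprSr -addrA nat1r.
Qed.

Lemma ws_f_eX n : f * e ^+ n.+1 = e ^+ n * (f * e - n%:R).
Proof.
elim: n => [|n IH]; first by rewrite expr1 expr0 mul1r subr0.
rewrite exprSr mulrA IH -mulrA mulrBl ws_e_fe -(commr_nat e) -mulrBr.
by rewrite mulrA -exprSr -addrA -opprD nat1r.
Qed.

Lemma ws_E_FX n :
  E * F ^+ n.+1 = F ^+ n * (F * E + n.+1%:R * (H - n%:R)).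
Proof.
elim: n => [|n IH].
  by rewrite expr1 expr0 !mul1r subr0 lieE (ws_EF ws).
rewrite exprSr mulrA IH -mulrA mulrDl -[F * E * F]mulrA (lieE E F) (ws_EF ws).
rewrite -[_ * F]mulrA mulrBl ws_H_F -(commr_nat F) -mulrBr [n.+1%:R * _]mulrA.
rewrite -(commr_nat F) -[F * _ * _]mulrA -mulrDr mulrA -exprSr; congr (_ * _).
rewrite -addrA; congr (_ + _).
apply: (horner_identity (x := H) (p := 'X + n.+1%:R * ('X - 2 - n%:R))
  (q := n.+2%:R * ('X - n.+1%:R))).
- by rewrite -!natr1; ring.
- by rewrite !(rmorphD, rmorphM, rmorphN, rmorph_nat, rmorph1) /= horner_algX.
- by rewrite !(rmorphD, rmorphM, rmorphN, rmorph_nat, rmorph1) /= horner_algX.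
Qed.

Lemma ws_F_EX n :
  F * E ^+ n.+1 = E ^+ n * (F * E - n%:R * (H + n.+1%:R)).
Proof.
have FE : F * E = E * F - H by rewrite (lieE E F) (ws_EF ws) addrK.
elim: n => [|n IH]; first by rewrite expr1 expr0 !mul1r mul0r subr0.
rewrite exprSr mulrA IH -mulrA mulrBl {1}FE mulrBl -[E * F * E]mulrA ws_H_E.
rewrite -[n%:R * _ * E]mulrA mulrDl ws_H_E -(commr_nat E) -mulrDr.
rewrite [n%:R * _]mulrA -(commr_nat E) -[E * _ * _]mulrA -!mulrBr mulrA -exprSr.
congr (_ * _); rewrite -!addrA; congr (_ + _).
apply: (horner_identity (x := H) (p := - ('X + 2) - n%:R *
  ('X + (1 + (1 + n.+1%:R))))
  (q := - (n.+1%:R * ('X + (1 + n.+1%:R))))).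
- by rewrite -!natr1; ring.
- by rewrite !(rmorphD, rmorphM, rmorphN, rmorph_nat, rmorph1) /= horner_algX.
- by rewrite -[n.+2%:R]nat1r !(rmorphD, rmorphM, rmorphN, rmorph_nat, rmorph1)
    /= horner_algX.
Qed.

Definition casimir : A := H ^+ 2 + 2 *: H + 4 *: (F * E).

Lemma casimir_central :
  [/\ lie casimir e = 0, lie casimir f = 0, lie casimir E = 0,
      lie casimir F = 0 & lie casimir H = 0].
Proof.
case: ws => ef Ee Ef Fe Ff He Hf HE HF EF.
have FE : lie F E = - H by rewrite lieC EF.
have FH : lie F H = 2 *: F by rewrite lieC HF opprK.
have EH : lie E H = - (2 *: E) by rewrite lieC HE.
split; rewrite /casimir ?lie_simpE
  ?(ef, Ee, Ef, Fe, Ff, He, Hf, HE, HF, EF, FE, FH, EH) ?ring_simpE //.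
- rewrite -scalerAr -scalerAl; apply/eqP; rewrite subr_eq0 -addrA -scalerDr.
  by rewrite -HE -lieE -scalerDl -natrD.
- rewrite -scalerAr -scalerAl; apply/eqP; rewrite addr_eq0 -!opprD eqr_opp.
  by rewrite addrAC -scalerDr -FH -lieE -scalerDl -natrD.
- by rewrite -scalerAr -scalerAl addNr scaler0.
Qed.

End Consequences.
End Splitting.

(** * Universal property of the enveloping algebra *)

Section UniversalProperty.
Variables (C : numClosedFieldType) (B : algType C) (r : jgen -> B).

Definition word_eval (m : {fmonom jgen}) : B := \prod_(i <- (m : seq jgen)) r i.

Lemma word_eval_morph : mmorphism word_eval.
Proof.
by split=> [x y|]; rewrite /word_eval ?fmM ?big_cat // fm1 big_nil.
Qed.

HB.instance Definition _ := monalg.isMultiplicative.Build {fmonom jgen} B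
  word_eval
  word_eval_morph.

Definition free_eval (x : free_alg C jgen) : B := mmap (in_alg B) word_eval x.

Lemma free_eval_linear : linear free_eval.
Proof.
move=> a x y; rewrite /free_eval.
by rewrite (mmapD (f := in_alg B) (h := word_eval)) mmapZ mulr_algl.
Qed.

HB.instance Definition _ :=
  GRing.isLinear.Build C (free_alg C jgen) B *:%R free_eval free_eval_linear.

Lemma free_eval_monoid : monoid_morphism free_eval.
Proof.
have cm (g : {malg C[{fmonom jgen}]}) m m' :
    GRing.comm (in_alg B g@_m) (word_eval m').
  by rewrite /GRing.comm mulr_algl mulr_algr.
have [fM f1] := commr_mmap_is_multiplicative cm.
by split=> // x y; rewrite -fM -free_mulE.
Qed.

HB.instance Definition _ :=
  GRing.isMonoidMorphism.Build (free_alg C jgen) B free_eval free_eval_monoid.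

Lemma free_eval_gen i : free_eval (free_gen C i) = r i.
Proof.
by rewrite /free_eval mmapU /= scale1r mul1r /word_eval fmU big_seq1.
Qed.
End UniversalProperty.

Lemma jbasis_sum (C : numClosedFieldType) (V : lmodType C) (r : jgen -> V) i :
  \sum_l jbasis C i l *: r l = r i.
Proof.
rewrite (bigD1 i) //= ffunE eqxx scale1r big1 ?addr0 // => j /negbTE ji.
by rewrite ffunE ji scale0r.
Qed.

Section EnvelopingLift.
Variables (C : numClosedFieldType) (B : algType C) (r : jgen -> B).

(** Values on the basis that respect the brackets of basis vectors; by
bilinearity this suffices to kill all the relations defining [jU]. *)
Definition jrep : Prop := forall i j,
  lie (r i) (r j) = \sum_l (jstruct C i j - jstruct C j i) l *: r l.

Definition jU_lift (u : jU C) : B := free_eval r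
  (repr (u : Quotient.quot (jrel_ideal C))).

Hypothesis rP : jrep.

Lemma free_eval_inj x : free_eval r (jtensor_inj x) = \sum_i x i *: r i.
Proof.
rewrite jtensor_injE linear_sum; apply: eq_bigr => i _.
by rewrite linearZ /= free_eval_gen.
Qed.

Lemma free_eval_ideal x : x \in jrel_ideal C -> free_eval r x = 0.
Proof.
move=> /asboolP /(_ [set u | free_eval r u = 0]) H;
  apply: H => [|_ [x1 [y1 ->]]]; rewrite /mkset.
  split=> [|u v|a u u0]; first exact: raddf0.
    by move=> u0 v0; rewrite raddfB /= u0 v0 subr0.
  by split; rewrite rmorphM /= u0 ?mulr0 ?mul0r.
rewrite 2!raddfB /= !rmorphM /= !free_eval_inj; apply/eqP; rewrite subr_eq0.
rewrite -/(lie _ _); apply/eqP.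
transitivity (\sum_i \sum_j (x1 i * y1 j) *: lie (r i) (r j)).
  rewrite /lie !big_distrlr [X in _ - X]exchange_big /= -sumrB.
  apply: eq_bigr => i _; rewrite -sumrB; apply: eq_bigr => j _.
  by rewrite -!scalerAl -!scalerAr !scalerA scalerBr [y1 j * _]mulrC.
rewrite /jbracket.
transitivity (\sum_i \sum_j \sum_l
   ((x1 i * y1 j) *: (jstruct C i j - jstruct C j i)) l *: r l).
  apply: eq_bigr => i _; apply: eq_bigr => j _; rewrite rP scaler_sumr.
  apply: eq_bigr => l _; rewrite scalerA; congr (_ *: _).
  by rewrite [RHS]ffunE.
rewrite exchange_big /= (eq_bigr (fun j => \sum_l
  (\sum_i (x1 i * y1 j) *: (jstruct C i j - jstruct C j i)) l *: r l)) //.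
  rewrite exchange_big /=; apply: eq_bigr => l _;
    rewrite [in RHS]exchange_big /=.
  by rewrite sum_ffunE -scaler_suml; congr (_ *: _); apply: eq_bigr => j _.
move=> j _; rewrite exchange_big /=; apply: eq_bigr => l _.
by rewrite sum_ffunE -scaler_suml.
Qed.

Lemma jU_liftE x : jU_lift (algquot_pi (jrel_ideal C) x) = free_eval r x.
Proof.
apply/eqP; rewrite -subr_eq0 -raddfB; apply/eqP/free_eval_ideal.
exact: repr_algquot_pi.
Qed.

Lemma jU_lift_linear : linear jU_lift.
Proof.
move=> a x y; have [u ->] := algquot_pi_surj x;
  have [v ->] := algquot_pi_surj y.
by rewrite -linearP !jU_liftE linearP.
Qed.

Lemma jU_liftM u v : jU_lift (u * v) = jU_lift u * jU_lift v.
Proof.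
have [x ->] := algquot_pi_surj u; have [y ->] := algquot_pi_surj v.
by rewrite -rmorphM !jU_liftE rmorphM.
Qed.

Lemma jU_lift1 : jU_lift 1 = 1.
Proof.
by rewrite -[1](rmorph1 (algquot_pi (jrel_ideal C))) jU_liftE rmorph1.
Qed.

Lemma jU_lift_gen i : jU_lift (jgenU C i) = r i.
Proof. by rewrite /jgenU /jinj jU_liftE free_eval_inj jbasis_sum. Qed.

End EnvelopingLift.

Section EnvelopingInduction.
Variables (C : numClosedFieldType) (Q : jU C -> Prop).
Hypothesis Qscal : forall a, Q a%:A.
Hypothesis QD : forall u v, Q u -> Q v -> Q (u + v).
Hypothesis QM : forall u v, Q u -> Q v -> Q (u * v).
Hypothesis Qgen : forall i, Q (jgenU C i).

Local Notation pi := (algquot_pi (jrel_ideal C)).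

Lemma pi_free_gen i : pi (free_gen C i) = jgenU C i.
Proof. by rewrite /jgenU /jinj jtensor_injE jbasis_sum. Qed.

(** The basis of the Lie algebra generates its enveloping algebra; this is how
every statement about all of [jU] is reduced to the six generators. *)
Lemma jU_ind u : Q u.
Proof.
have [x ->] := algquot_pi_surj u.
rewrite [x](monalgE (x : {malg C[{fmonom jgen}]})) raddf_sum /=.
apply: (big_ind Q) => [|//|m _]; first by have := Qscal 0; rewrite scale0r.
have -> : << x@_m *g m >> = x@_m *: (<< m >> : free_alg C jgen).
  by apply/malgP => k; rewrite mcoeffZ !mcoeffU mulrnAr mulr1.
suff Qm : Q (pi << m >>).
  by have := QM (Qscal x@_m) Qm; rewrite mulr_algl linearZ.
case: m => s; elim: s => [|i s IH].
  by have := Qscal 1; rewrite scale1r -fmoneE.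
have -> : << FMonom (i :: s) >> =
    free_gen C i * (<< FMonom s >> : free_alg C jgen).
  rewrite /GRing.mul /= free_mulE malgM_def fgmulUU mulr1.
  by congr << _ >>; apply/val_inj; rewrite /= fmM fmU.
rewrite rmorphM /= pi_free_gen; exact: QM.
Qed.

End EnvelopingInduction.

Section JacobiGenerators.
Variables (C : numClosedFieldType) (B : algType C) (H E F e f : B).

Definition jacobi_gens (i : jgen) : B :=
  match i with
  | tH => H | tE => E | tF => F | te => e | tf => f | tZ => - 2^-1%:A
  end.

Lemma jacobi_gens_rep : jacobi_rels H E F e f -> jrep jacobi_gens.
Proof.
move=> [HE HF EF He Hf Ee Ef Fe Ff ef] i j.
pose S (x : jacobi C) : B := \sum_l x l *: jacobi_gens l.
have SD x y : S (x + y) = S x + S y.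
  by rewrite /S -big_split; apply: eq_bigr => l _; rewrite ffunE scalerDl.
have SZ a x : S (a *: x) = a *: S x.
  by rewrite /S scaler_sumr; apply: eq_bigr => l _; rewrite ffunE scalerA.
have SN x : S (- x) = - S x by rewrite -scaleN1r SZ scaleN1r.
have Sb l : S (jbasis C l) = jacobi_gens l by exact: jbasis_sum.
have S0 : S 0 = 0 by rewrite -(scale0r (jbasis C tH)) SZ scale0r.
rewrite -/(S _) SD SN.
have lieZ x a : lie x a%:A = 0 by rewrite lieZr lie1r scaler0.
have Zlie x a : lie a%:A x = 0 by rewrite lieC lieZ oppr0.
have tZ2 : 2 *: (- 2^-1%:A) = - 1 :> B by rewrite scalerN double_half.
case: i; case: j => /=; rewrite ?(SN, SZ, S0, Sb) /= ?lieNr ?lieNl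
  ?(lieZ, Zlie, liexx)
  ?(HE, HF, EF, He, Hf, Ee, Ef, Fe, Ff, ef) ?tZ2 ?oppr0 ?opprK ?addr0 ?add0r //;
 by rewrite lieC ?(HE, HF, EF, He, Hf, Ee, Ef, Fe, Ff, ef) ?oppr0 ?opprK.
Qed.

End JacobiGenerators.

(** * Endomorphisms of a space of functions *)

Section Endomorphisms.
Variables (C : numClosedFieldType) (G : zmodType).

(** All functions are allowed, not only those of finite support: the operators
below are weighted shifts, whose value at a point involves a single value of
the argument. *)
Definition fspace : Type := G -> C^o.
HB.instance Definition _ := GRing.Lmodule.on fspace.

Definition is_linear_pred : {pred fspace -> fspace} := fun T => `[< linear T >].

Lemma is_linear_submod : submod_closed is_linear_pred.
Proof.
split=> [|a S T /asboolP lS /asboolP lT]; apply/asboolP => b x y.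
  by rewrite [RHS](_ : _ = b *: 0 + 0 :> fspace) // scaler0 addr0.
have E z : (a *: S + T) z = a *: S z + T z by [].
rewrite !E lS lT !scalerDr !scalerA [b * a]mulrC !addrA; congr (_ + _).
by rewrite -!addrA; congr (_ + _); rewrite addrC.
Qed.

HB.instance Definition _ := GRing.isSubmodClosed.Build C (fspace -> fspace)
  is_linear_pred is_linear_submod.

Record endo := Endo { endo_fun :> fspace -> fspace;
  _ : endo_fun \in is_linear_pred }.
HB.instance Definition _ := [isSub for endo_fun].
HB.instance Definition _ := [Choice of endo by <:].
HB.instance Definition _ := [SubChoice_isSubLmodule of endo by <:].

Lemma endo_linear (T : endo) : linear T.
Proof. by case: T => T /= /asboolP. Qed.

Lemma endoP (S T : endo) : (forall x, S x = T x) -> S = T.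
Proof. by move=> e; apply/val_inj/funext. Qed.

Lemma endoZ a (S : endo) x : (a *: S) x = a *: S x. Proof. by []. Qed.

Lemma endo_addr (T : endo) x y : T (x + y) = T x + T y.
Proof. by have := endo_linear T 1 x y; rewrite !scale1r. Qed.

Lemma endo_scale (T : endo) a x : T (a *: x) = a *: T x.
Proof.
have T0 : T 0 = 0 by apply: (addrI (T 0)); rewrite -endo_addr !addr0.
by have := endo_linear T a x 0; rewrite T0 !addr0.
Qed.

Fact endo_one_key : (id : fspace -> fspace) \in is_linear_pred.
Proof. by apply/asboolP. Qed.
Definition endo_one : endo := Endo endo_one_key.

Fact endo_mul_key (S T : endo) : S \o T \in is_linear_pred.
Proof. by apply/asboolP => a x y; rewrite /= !endo_linear. Qed.
Definition endo_mul (S T : endo) : endo := Endo (endo_mul_key S T).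

Lemma endo_mulA : associative endo_mul.
Proof. by move=> S T U; apply: endoP. Qed.
Lemma endo_mul1 : left_id endo_one endo_mul.
Proof. by move=> T; apply: endoP. Qed.
Lemma endo_mulr1 : right_id endo_one endo_mul.
Proof. by move=> T; apply: endoP. Qed.
Lemma endo_mulDl : left_distributive endo_mul +%R.
Proof. by move=> S T U; apply: endoP. Qed.
Lemma endo_mulDr : right_distributive endo_mul +%R.
Proof. by move=> S T U; apply: endoP => x; exact: endo_addr. Qed.

Lemma endo_one_neq0 : endo_one != 0.
Proof.
apply/eqP => /(congr1 (fun T : endo => T (fun _ => 1) 0)) /eqP.
by rewrite /= oner_eq0.
Qed.

HB.instance Definition _ := GRing.Zmodule_isNzRing.Build endo
  endo_mulA endo_mul1 endo_mulr1 endo_mulDl endo_mulDr endo_one_neq0.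

Lemma endo_scaleAl a (S T : endo) : a *: (S * T) = a *: S * T.
Proof. exact: endoP. Qed.
HB.instance Definition _ := GRing.Lmodule_isLalgebra.Build C endo endo_scaleAl.

Lemma endo_scaleAr a (S T : endo) : a *: (S * T) = S * (a *: T).
Proof. by apply: endoP => x; rewrite endoZ; exact/esym/endo_scale. Qed.
HB.instance Definition _ := GRing.Lalgebra_isAlgebra.Build C endo endo_scaleAr.

Lemma endoM (S T : endo) x : (S * T) x = S (T x). Proof. by []. Qed.

(** Weighted shifts are closed under composition, so that a commutation relation
between them is a pointwise identity between weights. *)
Definition wshift_fun (d : G) (w : G -> C) (x : fspace) : fspace :=
  fun p => w p * x (p + d).

Fact wshift_key d w : wshift_fun d w \in is_linear_pred.
Proof.
apply/asboolP => a x y; apply/funext => p.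
rewrite /wshift_fun /= [LHS](_ : _ = w p * (a * x (p + d) + y (p + d))) //.
by rewrite mulrDr mulrCA.
Qed.

Definition wshift d w : endo := Endo (wshift_key d w).

Lemma wshiftE d w x p : wshift d w x p = w p * x (p + d). Proof. by []. Qed.

Lemma wshiftM d w d' w' :
  wshift d w * wshift d' w' = wshift (d + d') (fun p => w p * w' (p + d)).
Proof.
by apply: endoP => x; apply/funext => p; rewrite endoM !wshiftE mulrA addrA.
Qed.

Lemma wshiftB d w w' : wshift d w - wshift d w' = wshift d
  (fun p => w p - w' p).
Proof.
apply: endoP => x; apply/funext => p; rewrite wshiftE mulrBl -!wshiftE.
by rewrite [LHS](_ : _ = wshift d w x p - wshift d w' x p).
Qed.

Lemma wshiftZ a d w : a *: wshift d w = wshift d (fun p => a * w p).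
Proof. by apply: endoP => x; apply/funext => p; rewrite wshiftE -mulrA. Qed.

Definition fdelta (q : G) : fspace := fun p => (p == q)%:R.

Lemma wshift_delta d w q : wshift d w (fdelta q) = w (q - d) *: fdelta (q - d).
Proof.
apply/funext => p; rewrite wshiftE /fdelta eq_sym -subr_eq eq_sym.
rewrite [RHS](_ : _ = w (q - d) * (p == q - d)%:R) //.
by case: eqP => [->//|_]; rewrite !mulr0.
Qed.

End Endomorphisms.

(** * The tensor product of a Weyl module and an sl2-module *)

Section WeightModuleOperators.
Variables (C : numClosedFieldType) (k c l : C).
Local Notation G := (int * int)%type.
Local Notation shift := (@wshift C G).

(** The factor 0 or 1 put on a raising operator so that it vanishes exactly
where its composite with the opposite lowering operator does.  This does not
alter the commutation relations and makes the module semisimple. *)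
Definition gate (a : C) : C := (a != 0)%:R.

Lemma gate_mul a : gate a * a = a.
Proof. by rewrite /gate; case: eqP => [->|_]; rewrite ?mulr0 ?mul1r. Qed.

(** The pair (n, m) indexes the tensor product of x^b, b = l - k - 1/2 + n, and
of a vector of sl2-weight l + 2 m.  Its H-weight is k + 2 m - n. *)
Definition xexp (n : int) : C := l - k - 2^-1 + n%:~R.
Definition sl2_coef (m : int) : C := (c + 1 - (l + 2 * m%:~R + 1) ^+ 2) / 4.

Definition op_e := shift (1, 0) (fun p => xexp (p.1 + 1)).
Definition op_f := shift (-1, 0) (fun p => gate (xexp p.1)).
Definition op_E := shift (0, -1) (fun p => gate (sl2_coef (p.2 - 1))).
Definition op_F := shift (0, 1) (fun p => sl2_coef p.2).
Definition op_H := shift 0 (fun p => l + 2 * p.2%:~R).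

Lemma eq_wshift d d' w w' : d = d' -> w =1 w' -> shift d w = shift d' w'.
Proof. by move=> -> /funext ->. Qed.

Lemma wshift1 : shift 0 (fun=> 1) = 1.
Proof.
by apply: endoP => x; apply/funext => p; rewrite wshiftE mul1r addr0.
Qed.

Lemma wshift_lie0 d w d' w' :
  (forall p, w p * w' (p + d) = w' p * w (p + d')) ->
  lie (shift d w) (shift d' w') = 0.
Proof.
move=> ww; apply: lie_comm; rewrite /GRing.comm !wshiftM.
by apply: eq_wshift => //; rewrite addrC.
Qed.

Lemma weight_ops_rels : weyl_sl2_rels op_e op_f op_E op_F op_H.
Proof.
split; try by apply: wshift_lie0 => -[n m] /=; rewrite ?addr0 // mulrC.
- rewrite /lie !wshiftM wshiftB -wshift1; apply: eq_wshift => //= -[n m] /=.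
  rewrite subrK mulrC !gate_mul /xexp intrD; ring.
- rewrite /lie !wshiftM !addr0 !add0r wshiftB wshiftZ.
  apply: eq_wshift => //= -[n m] /=; rewrite ?addr0 intrD; ring.
- rewrite /lie !wshiftM !addr0 !add0r wshiftB -scaleNr wshiftZ.
  apply: eq_wshift => //= -[n m] /=; rewrite ?addr0 intrD; ring.
rewrite /lie !wshiftM wshiftB; apply: eq_wshift => //= -[n m] /=.
by rewrite addrK gate_mul mulrC gate_mul /sl2_coef intrB; field.
Qed.

End WeightModuleOperators.

(** * The quotient A = U(g)/(Z + 1/2) *)

Section Localization.
Variable C : numClosedFieldType.
Local Notation U := (jU C).
Local Notation uZ := (jgenU C tZ).

Definition weight_rep (k c l : C) : U -> endo C (int * int)%type :=
  jU_lift (jacobi_gens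
    (op_H l - op_f k l * op_e k l - 2^-1%:A)
    (op_E c l - 2^-1 *: op_e k l ^+ 2)
    (op_F c l + 2^-1 *: op_f k l ^+ 2) (op_e k l) (op_f k l)).

Lemma weight_jrep (k c l : C) : jrep (jacobi_gens
    (op_H l - op_f k l * op_e k l - 2^-1%:A)
    (op_E c l - 2^-1 *: op_e k l ^+ 2)
    (op_F c l + 2^-1 *: op_f k l ^+ 2) (op_e k l) (op_f k l)).
Proof. exact/jacobi_gens_rep/jacobi_of_split/weight_ops_rels. Qed.

Lemma jgenU_central u : GRing.comm uZ u.
Proof.
elim/jU_ind: u => [a|u v|u v|i].
- exact/jcommZ_scale/commr1.
- exact: commrD.
- exact: commrM.
- exact: jgenUZ.
Qed.

Definition Zideal : {pred U} := fun u =>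
  `[< exists b, u = b * (uZ + 2^-1%:A) >].

Lemma Zideal_zmod_closed : zmod_closed Zideal.
Proof.
split=> [|u v /asboolP [a ->] /asboolP [b ->]]; apply/asboolP.
  by exists 0; rewrite mul0r.
by exists (a - b); rewrite mulrBl.
Qed.
HB.instance Definition _ := GRing.isZmodClosed.Build U Zideal
  Zideal_zmod_closed.

Lemma ZidealMl a : {in Zideal, forall u, a * u \in Zideal}.
Proof.
by move=> u /asboolP [b ->]; apply/asboolP; exists (a * b); rewrite mulrA.
Qed.

Lemma ZidealMr a : {in Zideal, forall u, u * a \in Zideal}.
Proof.
move=> u /asboolP [b ->]; apply/asboolP; exists (b * a).
rewrite -!mulrA; congr (b * _).
by rewrite mulrDl mulrDr (jgenU_central a) mulr_algl mulr_algr.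
Qed.

HB.instance Definition _ := isTwoSided.Build U Zideal ZidealMl ZidealMr.

Definition jA := @algquot C U Zideal.
HB.instance Definition _ := GRing.PzRing.on jA.
HB.instance Definition _ := GRing.Lmodule.on jA.

(** Z + 1/2 acts by zero in the representation constructed above. *)
Lemma Zideal_one : (1 : U) \notin Zideal.
Proof.
apply/negP => /asboolP [b] /(congr1 (weight_rep 0 0 0)) /eqP.
have rP := weight_jrep 0 0 0.
rewrite /weight_rep jU_lift1 // jU_liftM // [uZ + _]addrC.
rewrite (jU_lift_linear rP) jU_lift1 // jU_lift_gen //= subrr mulr0.
by rewrite oner_eq0.
Qed.

Lemma jA_one_neq0 : (1 : jA) != 0.
Proof.
apply/eqP => e; have {e} : algquot_pi Zideal 1 = algquot_pi Zideal 0.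
  by rewrite raddf0; exact: e.
by move/(introT (algquot_piP _ _ _)); rewrite subr0; apply/negP/Zideal_one.
Qed.

HB.instance Definition _ := GRing.PzSemiRing_isNonZero.Build jA jA_one_neq0.
HB.instance Definition _ := GRing.Lmodule_isLalgebra.Build C jA
  (@algquot_scaleAl C U Zideal).
HB.instance Definition _ := GRing.Lalgebra_isAlgebra.Build C jA
  (@algquot_scaleAr C U Zideal).
End Localization.

Section LocalizedRelations.
Variable C : numClosedFieldType.
Local Notation U := (jU C).
Local Notation uH := (jgenU C tH).
Local Notation uE := (jgenU C tE).
Local Notation uF := (jgenU C tF).
Local Notation ue := (jgenU C te).
Local Notation uf := (jgenU C tf).
Local Notation uZ := (jgenU C tZ).

Definition piA (u : U) : jA C := algquot_pi (@Zideal C) u.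

Lemma piA_linear : linear piA.
Proof. by move=> a u v; rewrite /piA raddfD /= linearZ. Qed.
HB.instance Definition _ := GRing.isLinear.Build C U (jA C) *:%R piA piA_linear.

Lemma piA_monoid : monoid_morphism piA.
Proof. by split=> [|u v]; rewrite /piA ?rmorph1 ?rmorphM. Qed.
HB.instance Definition _ := GRing.isMonoidMorphism.Build U (jA C) piA
  piA_monoid.

Lemma piAP u v : piA u = piA v <-> u - v \in @Zideal C.
Proof. by split=> [/algquot_piP //|H]; apply/algquot_piP. Qed.

Lemma piA_lie u v : piA (lie u v) = lie (piA u) (piA v).
Proof. by rewrite /lie rmorphB !rmorphM. Qed.

Lemma piA_Z : piA uZ = - 2^-1%:A.
Proof.
apply/eqP; rewrite -addr_eq0 -[_%:A](_ : piA 2^-1%:A = _); last first.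
  by rewrite linearZ rmorph1.
rewrite -rmorphD -(raddf0 piA); apply/eqP/piAP; rewrite subr0.
by apply/asboolP; exists 1; rewrite mul1r.
Qed.

Lemma jgenU_lie i j :
  lie (jgenU C i) (jgenU C j) = jinj (jstruct C i j - jstruct C j i).
Proof. by rewrite /lie jinj_bracket jbracket_basis. Qed.

Lemma jA_jacobi : jacobi_rels (piA uH) (piA uE) (piA uF) (piA ue) (piA uf).
Proof.
split; rewrite -piA_lie jgenU_lie ?subr0 /= ?linear0 ?raddf0 //.
- by rewrite (linearZ_LR (@jinj C)) linearZ.
- by rewrite raddfN /= (linearZ_LR (@jinj C)) raddfN /= [piA (_ *: _)]linearZ.
- by rewrite raddfN /= raddfN.
- by rewrite raddfN /= raddfN.
- by rewrite raddfN /= raddfN.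
by rewrite raddfN /= (linearZ_LR (@jinj C)) raddfN /= [piA (_ *: _)]linearZ /=
  piA_Z scalerN opprK double_half.
Qed.

Local Notation aH := (piA uH).
Local Notation ae := (piA ue).
Local Notation af := (piA uf).
Local Notation aE := (piA (jEnu C)).
Local Notation aF := (piA (jFnu C)).
Local Notation aHn := (piA (jHnu C)).

Lemma jA_split : weyl_sl2_rels ae af aE aF aHn.
Proof.
have -> : aE = piA uE + 2^-1 *: ae ^+ 2.
  by rewrite rmorphD /= linearZ /= rmorphXn.
have -> : aF = piA uF - 2^-1 *: af ^+ 2.
  by rewrite rmorphB /= linearZ /= rmorphXn.
have -> : aHn = aH + af * ae + 2^-1%:A.
  by rewrite !rmorphD /= rmorphM /= linearZ /= rmorph1.
exact: split_of_jacobi jA_jacobi.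
Qed.

Lemma piA_casimir : piA (jcasimir C) = casimir aE aF aHn.
Proof.
rewrite /jcasimir; move: (jEnu C) (jFnu C) (jHnu C) => E F H.
by rewrite !rmorphD /= rmorphXn /= ![piA (_ *: _)]linearZ /= rmorphM.
Qed.

Lemma piA_calE : piA (jcalE C) = af * ae + 2^-1%:A.
Proof.
rewrite linearZ /= rmorphD /= !rmorphM /= (lieE ae af) (ws_ef jA_split).
by rewrite addrA scalerDr half_double.
Qed.

Lemma piA_Hnu : piA (jHnu C) = aH + piA (jcalE C).
Proof. by rewrite piA_calE !rmorphD /= rmorphM /= linearZ /= rmorph1 addrA. Qed.

(** E and F are polynomials in the split generators, so these generate A
together with H. *)
Lemma piA_ind (Q : jA C -> Prop) :
  (forall a, Q a%:A) -> (forall x y, Q x -> Q y -> Q (x + y)) ->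
  (forall x y, Q x -> Q y -> Q (x * y)) ->
  Q aH -> Q ae -> Q af -> Q aE -> Q aF -> forall u, Q (piA u).
Proof.
move=> Qscal QD QM QH Qe Qf QE QF.
have QZ a x : Q x -> Q (a *: x) by rewrite -mulr_algl; exact: QM.
elim/jU_ind => [a|u v|u v|i].
- by rewrite linearZ /= rmorph1.
- by rewrite rmorphD; exact: QD.
- by rewrite rmorphM; exact: QM.
case: i => //.
- rewrite -[jgenU C tE](addrK (2^-1 *: ue ^+ 2)) -/(jEnu C) -scaleNr rmorphD /=.
  by rewrite linearZ /= expr2 rmorphM; apply: (QD _ _ QE); apply/QZ/QM.
- rewrite -[jgenU C tF](subrK (2^-1 *: uf ^+ 2)) -/(jFnu C) rmorphD /=.
  by rewrite linearZ /= expr2 rmorphM; apply: (QD _ _ QF); apply/QZ/QM.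
by rewrite piA_Z -scaleNr.
Qed.

End LocalizedRelations.

(** * Spanning the commutant of H *)

Section Spanning.
Variable C : numClosedFieldType.
Local Notation U := (jU C).
Local Notation uH := (jgenU C tH).
Local Notation ue := (jgenU C te).
Local Notation uf := (jgenU C tf).
Local Notation aH := (piA uH).
Local Notation ae := (piA ue).
Local Notation af := (piA uf).
Local Notation aE := (piA (jEnu C)).
Local Notation aF := (piA (jFnu C)).
Local Notation aHn := (piA (jHnu C)).

Lemma jwtX n (u : U) m : jwt n u -> jwt (n *+ m) (u ^+ m).
Proof.
move=> un; elim: m => [|m IH]; first by rewrite expr0 mulr0n -[1]scale1r;
  exact: jwt1.
by rewrite exprS mulrS; exact: jwtM.
Qed.

Lemma jwtEnu : jwt 2 (jEnu C).
Proof. by apply: jwtD (jwtE C) _; apply/jwtZ/jwtX2/jwte. Qed.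

Lemma jwtFnu : jwt (- 2) (jFnu C).
Proof.
apply: jwtD (jwtF C) _; rewrite -scaleNr; apply: jwtZ.
by rewrite opprD; exact: jwtX2 (jwtf C).
Qed.

(** Signed powers: f^p for p >= 0 and e^(-p) for p < 0; below, E_nu^q and
F_nu^(-q). *)
Definition fe_pow (p : int) : U := (if 0 <= p then uf else ue) ^+ `|p|.
Definition EF_pow (q : int) : U := (if 0 <= q then jEnu C else jFnu C) ^+ `|q|.

Lemma absz_signr (p : int) (a : C) :
  (if 0 <= p then a else - a) *+ `|p| = p%:~R * a.
Proof.
case: p => n /=; first by rewrite mulr_natl.
by rewrite NegzE mulrNz mulNr mulNrn mulr_natl.
Qed.

Lemma jwt_fe_pow p : jwt (- p%:~R) (fe_pow p).
Proof.
rewrite -mulrN1 -absz_signr opprK; apply: jwtX.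
by case: ifP => _; [exact: jwtf|exact: jwte].
Qed.

Lemma jwt_EF_pow q : jwt (q%:~R * 2) (EF_pow q).
Proof.
rewrite -absz_signr; apply: jwtX.
by case: ifP => _; [exact: jwtEnu|exact: jwtFnu].
Qed.

Lemma H_commutant : uH \in @jcommutant C.
Proof. by apply: jcommutant_wt; [exact: jwtH|exact: jgenUZ]. Qed.

Lemma raise_commutant : uf ^+ 2 * jEnu C \in @jcommutant C.
Proof.
apply: jcommutant_wt; last exact: jgenU_central.
have := jwtM (jwtX 2 (jwtf C)) jwtEnu.
by rewrite mulNrn addNr.
Qed.

Lemma lower_commutant : ue ^+ 2 * jFnu C \in @jcommutant C.
Proof.
apply: jcommutant_wt; last exact: jgenU_central.
have := jwtM (jwtX 2 (jwte C)) jwtFnu.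
by rewrite subrr.
Qed.

Definition kH : jUk C := JUk H_commutant.
Definition kcalE : jUk C := JUk (jcalE_commutant C).
Definition kcasimir : jUk C := JUk (jcasimir_commutant C).
Definition kraise : jUk C := JUk raise_commutant.
Definition klower : jUk C := JUk lower_commutant.

Definition ktrans (q : int) : jUk C :=
  (if 0 <= q then kraise else klower) ^+ `|q|.

(** On a weight vector with a given Casimir value these elements act by
scalars. *)
Inductive diag : jUk C -> Prop :=
  | diag_scal a : diag a%:A
  | diag_H : diag kH
  | diag_calE : diag kcalE
  | diag_casimir : diag kcasimir
  | diagD u v : diag u -> diag v -> diag (u + v)
  | diagM u v : diag u -> diag v -> diag (u * v).

Definition piK (u : jUk C) : jA C := piA (val u).

Lemma piK_linear : linear piK.
Proof. by move=> a u v; rewrite /piK (linearP val) /= linearP. Qed.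
HB.instance Definition _ := GRing.isLinear.Build C (jUk C) (jA C) *:%R piK
  piK_linear.
Lemma piK_monoid : monoid_morphism piK.
Proof.
by split=> [|u v]; rewrite /piK ?(rmorph1 val) ?(rmorphM val) /= ?rmorph1
  ?rmorphM.
Qed.
HB.instance Definition _ := GRing.isMonoidMorphism.Build (jUk C) (jA C) piK
  piK_monoid.

Definition diagA (x : jA C) : Prop := exists2 b, diag b & x = piK b.

Lemma diagA_scal a : diagA a%:A.
Proof. by exists a%:A; [exact: diag_scal|rewrite linearZ /= rmorph1]. Qed.

Lemma diagAD x y : diagA x -> diagA y -> diagA (x + y).
Proof.
by move=> [b db ->] [d dd ->]; exists (b + d); [exact: diagD|rewrite rmorphD].
Qed.

Lemma diagAM x y : diagA x -> diagA y -> diagA (x * y).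
Proof.
by move=> [b db ->] [d dd ->]; exists (b * d); [exact: diagM|rewrite rmorphM].
Qed.

Lemma diagAZ a x : diagA x -> diagA (a *: x).
Proof.
by move=> dx; rewrite -mulr_algl; apply: diagAM => //; exact: diagA_scal.
Qed.

Lemma diagAB x y : diagA x -> diagA y -> diagA (x - y).
Proof.
by move=> dx dy; apply: diagAD => //; rewrite -scaleN1r; exact: diagAZ.
Qed.

Lemma diagA_nat n : diagA n%:R.
Proof. by rewrite -scaler_nat; exact: diagA_scal. Qed.

Lemma diagA_fe : diagA (af * ae).
Proof.
rewrite -[_ * _](addrK 2^-1%:A) -piA_calE; apply: diagAB;
  last exact: diagA_scal.
by exists kcalE => //; exact: diag_calE.
Qed.

Lemma diagA_Hn : diagA aHn.
Proof.
rewrite piA_Hnu; apply: diagAD.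
  by exists kH => //; exact: diag_H.
by exists kcalE => //; exact: diag_calE.
Qed.

Lemma diagA_FE : diagA (aF * aE).
Proof.
have -> : aF * aE = 4^-1 *: (casimir aE aF aHn - (aHn ^+ 2 + 2 *: aHn)).
  by rewrite /casimir addrC addKr scalerA mulVf ?scale1r ?pnatr_eq0.
apply/diagAZ/diagAB.
  by rewrite -piA_casimir; exists kcasimir => //; exact: diag_casimir.
apply: diagAD; last exact/diagAZ/diagA_Hn.
by rewrite expr2; apply: diagAM; exact: diagA_Hn.
Qed.

Lemma fe_comm_EF_pow q : GRing.comm (af * ae) (piA (EF_pow q)).
Proof.
have [[Ee Ef Fe Ff] _] := ws_comm (jA_split C).
have cE : GRing.comm (af * ae) aE.
  by rewrite /GRing.comm -mulrA -Ee [LHS]mulrA -Ef mulrA.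
have cF : GRing.comm (af * ae) aF.
  by rewrite /GRing.comm -mulrA -Fe [LHS]mulrA -Ff mulrA.
by rewrite /EF_pow rmorphXn; apply: commrX; case: ifP.
Qed.

Lemma fe_pow_comm x p : GRing.comm x ae -> GRing.comm x af ->
  GRing.comm x (piA (fe_pow p)).
Proof.
by move=> xe xf; rewrite /fe_pow rmorphXn; apply: commrX; case: ifP.
Qed.

(** The left factor d is a polynomial in f e, hence commutes with the powers of
E_nu and F_nu and can be moved to the diagonal factor at the right end. *)
Lemma f_fe_pow p : exists2 d, diagA d /\
  (forall q, GRing.comm d (piA (EF_pow q)))
  & af * piA (fe_pow p) = piA (fe_pow (p + 1)) * d.
Proof.
have ws := jA_split C; case: p => n.
  exists 1; last by rewrite mulr1 /fe_pow /= addn1 !rmorphXn exprS.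
  by split=> [|q]; [exact: (diagA_nat 1)|apply/commr_sym/commr1].
exists (af * ae - n%:R).
  split=> [|q]; first by apply: diagAB (diagA_nat _); exact: diagA_fe.
  apply/commr_sym/commrB; last exact: commr_nat.
  exact/commr_sym/fe_comm_EF_pow.
case: n => [|n]; first by rewrite /fe_pow /= expr1 subr0 rmorph1 mul1r.
by rewrite /fe_pow /= !rmorphXn /= (ws_f_eX ws) subn1.
Qed.

Lemma e_fe_pow p : exists2 d, diagA d /\
  (forall q, GRing.comm d (piA (EF_pow q)))
  & ae * piA (fe_pow p) = piA (fe_pow (p - 1)) * d.
Proof.
have ws := jA_split C; case: p => [[|n]|n].
- exists 1; last by rewrite mulr1 (_ : 0 - 1 = Negz 0) // /fe_pow /= expr0
    rmorph1 mulr1.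
  by split=> [|q]; [exact: (diagA_nat 1)|apply/commr_sym/commr1].
- exists (af * ae + n.+1%:R).
    split=> [|q]; first by apply: diagAD (diagA_nat _); exact: diagA_fe.
    apply/commr_sym/commrD; last exact: commr_nat.
    exact/commr_sym/fe_comm_EF_pow.
  have -> : n.+1%:Z - 1 = n by rewrite intS addrC addKr.
  by rewrite /fe_pow /= !rmorphXn (ws_e_fX ws).
exists 1.
  by split=> [|q]; [exact: (diagA_nat 1)|apply/commr_sym/commr1].
have -> : Negz n - 1 = Negz n.+1 by rewrite !NegzE [n.+2%:Z]intS opprD addrC.
by rewrite mulr1 /fe_pow /= [ue ^+ n.+2]exprS rmorphM.
Qed.

Lemma E_EF_pow q : exists2 d, diagA d
  & aE * piA (EF_pow q) = piA (EF_pow (q + 1)) * d.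
Proof.
have ws := jA_split C; case: q => n.
  exists 1; last by rewrite mulr1 /EF_pow /= addn1 !rmorphXn exprS.
  exact: (diagA_nat 1).
exists (aF * aE + n.+1%:R * (aHn - n%:R)).
  apply: diagAD diagA_FE _; apply: diagAM (diagA_nat _) _.
  exact: diagAB diagA_Hn (diagA_nat _).
case: n => [|n]; rewrite /EF_pow /= !rmorphXn /= [LHS](ws_E_FX ws) //.
by rewrite subn1.
Qed.

Lemma F_EF_pow q : exists2 d, diagA d
  & aF * piA (EF_pow q) = piA (EF_pow (q - 1)) * d.
Proof.
have ws := jA_split C; case: q => [[|n]|n].
- exists 1; last by rewrite mulr1 (_ : 0 - 1 = Negz 0) // /EF_pow /= expr0
    rmorph1 mulr1.
  exact: (diagA_nat 1).
- exists (aF * aE - n%:R * (aHn + n.+1%:R)).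
    apply: diagAB diagA_FE _; apply: diagAM (diagA_nat _) _.
    exact: diagAD diagA_Hn (diagA_nat _).
  have -> : n.+1%:Z - 1 = n by rewrite intS addrC addKr.
  by rewrite /EF_pow /= !rmorphXn (ws_F_EX ws).
exists 1; first exact: (diagA_nat 1).
have -> : Negz n - 1 = Negz n.+1 by rewrite !NegzE [n.+2%:Z]intS opprD addrC.
by rewrite mulr1 /EF_pow /= [_ ^+ n.+2]exprS rmorphM.
Qed.

Lemma H_pows p q : aH * (piA (fe_pow p) * piA (EF_pow q)) =
  piA (fe_pow p) * piA (EF_pow q) * (aH + (- p%:~R + q%:~R * 2)%:A).
Proof.
have := jwtM (jwt_fe_pow p) (jwt_EF_pow q).
move: (- _ + _) => w wt; rewrite -!rmorphM wt rmorphD /= rmorphM /= linearZ /=.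
by rewrite mulrDr mulr_algr.
Qed.

Definition spanned (y : jA C) : Prop :=
  exists2 s : seq (int * int * jUk C), (forall t, t \in s -> diag t.2) &
    y = \sum_(t <- s) piA (fe_pow t.1.1) * piA (EF_pow t.1.2) * piK t.2.

Lemma spanned1 p q d : diagA d ->
  spanned (piA (fe_pow p) * piA (EF_pow q) * d).
Proof.
move=> [b db ->]; exists [:: (p, q, b)]; last by rewrite big_seq1.
by move=> t; rewrite inE => /eqP ->.
Qed.

Lemma spannedD x y : spanned x -> spanned y -> spanned (x + y).
Proof.
move=> [s ds ->] [t dt ->]; exists (s ++ t); last by rewrite big_cat.
by move=> u; rewrite mem_cat => /orP [/ds|/dt].
Qed.

Definition spanned_stable (x : jA C) : Prop :=
  forall y, spanned y -> spanned (x * y).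

Lemma spanned_stableP x :
  (forall p q d, diagA d -> spanned
    (x * (piA (fe_pow p) * piA (EF_pow q) * d))) ->
  spanned_stable x.
Proof.
move=> xP _ [s ds ->]; rewrite mulr_sumr big_seq.
apply: (big_ind spanned) => [|y z|t ts].
- by exists [::]; rewrite ?big_nil.
- exact: spannedD.
by apply: xP; exists t.2 => //; exact: ds.
Qed.

Lemma stableD x y : spanned_stable x -> spanned_stable y -> spanned_stable
  (x + y).
Proof.
by move=> sx sy z sz; rewrite mulrDl; apply: spannedD; [exact: sx|exact: sy].
Qed.

Lemma stableM x y : spanned_stable x -> spanned_stable y -> spanned_stable
  (x * y).
Proof. by move=> sx sy z sz; rewrite -mulrA; apply/sx/sy. Qed.

Lemma stable_scal a : spanned_stable a%:A.
Proof.
apply: spanned_stableP => p q d dd.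
rewrite mulr_algl scalerAr; apply: spanned1; exact: diagAZ.
Qed.

Lemma stableZ a x : spanned_stable x -> spanned_stable (a *: x).
Proof.
by move=> sx; rewrite -mulr_algl; apply: stableM => //; exact: stable_scal.
Qed.

Lemma stable_f : spanned_stable af.
Proof.
apply: spanned_stableP => p q d dd; have [d' [dd' cd'] e] := f_fe_pow p.
rewrite !mulrA e -[_ * d' * _]mulrA cd' -!mulrA mulrA.
by apply: spanned1; exact: diagAM.
Qed.

Lemma stable_e : spanned_stable ae.
Proof.
apply: spanned_stableP => p q d dd; have [d' [dd' cd'] e] := e_fe_pow p.
rewrite !mulrA e -[_ * d' * _]mulrA cd' -!mulrA mulrA.
by apply: spanned1; exact: diagAM.
Qed.

Lemma stable_E : spanned_stable aE.
Proof.
have [[Ee Ef Fe Ff] _] := ws_comm (jA_split C).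
apply: spanned_stableP => p q d dd; have [d' dd' e] := E_EF_pow q.
rewrite !mulrA (fe_pow_comm p Ee Ef) -[_ * aE * _]mulrA e -!mulrA mulrA.
by apply: spanned1; exact: diagAM.
Qed.

Lemma stable_F : spanned_stable aF.
Proof.
have [[Ee Ef Fe Ff] _] := ws_comm (jA_split C).
apply: spanned_stableP => p q d dd; have [d' dd' e] := F_EF_pow q.
rewrite !mulrA (fe_pow_comm p Fe Ff) -[_ * aF * _]mulrA e -!mulrA mulrA.
by apply: spanned1; exact: diagAM.
Qed.

Lemma stable_H : spanned_stable aH.
Proof.
apply: spanned_stableP => p q d dd; rewrite mulrA H_pows -mulrA.
apply/spanned1/diagAM => //; apply: diagAD (diagA_scal _).
by exists kH => //; exact: diag_H.
Qed.

(** The span of these products contains 1 and is stable under left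
multiplication by the generators. *)
Lemma jA_spanned u : spanned (piA u).
Proof.
suff st : spanned_stable (piA u).
  have := st 1; rewrite mulr1; apply.
  by have := spanned1 0 0 (diagA_nat 1);
    rewrite /fe_pow /EF_pow /= rmorph1 !mul1r.
apply: piA_ind.
- exact: stable_scal.
- exact: stableD.
- exact: stableM.
- exact: stable_H.
- exact: stable_e.
- exact: stable_f.
- exact: stable_E.
exact: stable_F.
Qed.

End Spanning.

(** Eigenvectors for different eigenvalues are independent modulo any stable
subspace S.  The induction applies T - b i to eliminate one summand, which
multiplies x by a - b i != 0.  It is used with S = 0, with S a submodule, and
with T = ad H and S the ideal of Z + 1/2. *)
Lemma eigen_separation (C : fieldType) (V : lmodType C) (T : V -> V)
    (S : {pred V}) (I : eqType) (s : seq I) (y : I -> V) (b : I -> C) (a : C)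
      x :
  linear T -> submod_closed S -> {in S, forall v, T v \in S} ->
  T x = a *: x ->
  {in s, forall i, b i != a /\ T (y i) = b i *: y i} ->
  x + \sum_(i <- s) y i \in S -> x \in S.
Proof.
move=> linT [S0 linS] TS; have SD u v : u \in S -> v \in S -> u + v \in S.
  by move=> uS vS; rewrite -[u]scale1r; exact: linS.
have SZ c u : u \in S -> c *: u \in S.
  by move=> uS; rewrite -[_ *: _]addr0; exact: linS.
have T0 : T 0 = 0 by have := linT (-1) 0 0;
  rewrite scaler0 addr0 scaleN1r addNr.
have TD u v : T (u + v) = T u + T v by rewrite -[u]scale1r linT !scale1r.
have TZ c u : T (c *: u) = c *: T u by rewrite -[c *: u]addr0 linT T0 addr0.
have Tsum (r : seq I) F : T (\sum_(i <- r) F i) = \sum_(i <- r) T (F i).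
  exact: (big_morph T TD T0).
elim: s x y => [|i s IH] x y Tx Ty; first by rewrite big_nil addr0.
rewrite big_cons => sumS.
have [bia Tyi] := Ty i (mem_head _ _).
have Tys j : j \in s -> b j != a /\ T (y j) = b j *: y j.
  by move=> js; apply: Ty; rewrite inE js orbT.
suff : (a - b i) *: x \in S.
  move=> /(SZ (a - b i)^-1); rewrite scalerA mulVf ?scale1r //.
  by rewrite subr_eq0 eq_sym.
apply: (IH _ (fun j => (b j - b i) *: y j)).
- by rewrite TZ Tx !scalerA mulrC.
- by move=> j js; have [ba Tj] := Tys j js; split=> //;
    rewrite TZ Tj !scalerA mulrC.
have := SD _ _ (TS _ sumS) (SZ (- b i) _ sumS).
rewrite !TD Tx Tyi Tsum !scalerDr scalerBl scaler_sumr.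
rewrite (_ : \sum_(j <- s) (b j - b i) *: y j =
  \sum_(j <- s) T (y j) + \sum_(j <- s) - b i *: y j); last first.
  rewrite -big_split /= !big_seq; apply: eq_bigr => j /Tys [_ ->].
  by rewrite scalerBl scaleNr.
rewrite !scaleNr; set w := b i *: y i; set t := \sum_(_ <- _) _;
  set t' := \sum_(_ <- _) _.
suff -> : a *: x + (w + t) + (- (b i *: x) + (- w + t')) =
  a *: x - b i *: x + (t + t') by [].
by rewrite addrACA; congr (_ + _); rewrite addrACA subrr add0r.
Qed.

Section Classes.
Variables (C : numClosedFieldType) (k : C).
Local Notation U := (jU C).

Definition cls (u : jUk C) : jD k := algquot_pi (jDideal k) u.

Lemma cls_linear : linear cls.
Proof. by move=> a u v; rewrite /cls raddfD /= linearZ. Qed.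
HB.instance Definition _ := GRing.isLinear.Build C (jUk C) (jD k) *:%R cls
  cls_linear.
Lemma cls_monoid : monoid_morphism cls.
Proof. by split=> [|u v]; rewrite /cls ?rmorph1 ?rmorphM. Qed.
HB.instance Definition _ := GRing.isMonoidMorphism.Build (jUk C) (jD k) cls
  cls_monoid.

Lemma cls_surj (d : jD k) : exists u, d = cls u.
Proof. exact: algquot_pi_surj. Qed.

Lemma clsP u v : cls u = cls v <-> u - v \in jDideal k.
Proof. by split=> [/algquot_piP //|H]; apply/algquot_piP. Qed.

Lemma cls_eq u v : piK u = piK v -> cls u = cls v.
Proof.
move=> /piAP /asboolP [b e]; apply/clsP/asboolP; exists 0, b.
by rewrite mul0r add0r jUk_valB e.
Qed.

Lemma cls_H : cls (kH C) = jD_scalar k k.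
Proof.
rewrite /jD_scalar -[1](rmorph1 cls) -linearZ; apply/clsP/asboolP; exists 1, 0.
by rewrite mul1r mul0r addr0 jUk_valB.
Qed.

Lemma piK_ktrans q :
  piK (ktrans C q) = piA (fe_pow C (2 * q)) * piA (EF_pow C q).
Proof.
have [[Ee Ef Fe Ff] _] := ws_comm (jA_split C).
rewrite /ktrans rmorphXn /= /fe_pow /EF_pow abszM pmulr_rge0 //.
rewrite !rmorphXn exprM; case: ifP => _ /=.
  rewrite /piK /= rmorphM rmorphXn exprMn_comm //.
  by apply/commr_sym/commrX.
rewrite /piK /= rmorphM rmorphXn exprMn_comm //.
by apply/commr_sym/commrX.
Qed.

(** Among the spanning products only those of ad H-weight 0 contribute to an
element commuting with H: the others are removed by [eigen_separation]. *)
Lemma cls_spanned u : exists2 s : seq (int * jUk C),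
  (forall t, t \in s -> diag t.2) &
  cls u = \sum_(t <- s) cls (ktrans C t.1) * cls t.2.
Proof.
have [s ds e] := jA_spanned (val u).
pose s0 := [seq t <- s | t.1.1 == 2 * t.1.2];
  pose s1 := [seq t <- s | t.1.1 != 2 * t.1.2].
exists [seq (t.1.2, t.2) | t <- s0].
  by move=> t' /mapP [t ts ->]; apply: ds; move: ts;
    rewrite mem_filter => /andP [].
transitivity (cls (\sum_(t <- s0) ktrans C t.1.2 * t.2)); last first.
  by rewrite rmorph_sum big_map; apply: eq_bigr => t _; exact: rmorphM.
apply: cls_eq; rewrite rmorph_sum /=.
pose term (t : int * int * jUk C) : U :=
  fe_pow C t.1.1 * EF_pow C t.1.2 * val t.2.
have wterm t : jwt (- t.1.1%:~R + t.1.2%:~R * 2) (term t).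
  rewrite -[_ + _]addr0; apply: jwtM.
    exact: jwtM (jwt_fe_pow _ _) (jwt_EF_pow _ _).
  by rewrite /jwt scale0r addr0; case: (jcommutantP _ (valP t.2)).
have piterm t :
    piA (term t) = piA (fe_pow C t.1.1) * piA (EF_pow C t.1.2) * piK t.2.
  by rewrite !rmorphM.
suff /piAP : val u - \sum_(t <- s0) term t \in @Zideal C.
  rewrite -/(piK u) => ->; rewrite rmorph_sum /= !big_filter.
  apply: eq_bigr => t /eqP e2; rewrite piterm rmorphM /= piK_ktrans.
  by rewrite e2.
apply: (@eigen_separation C U (fun v => lie (jgenU C tH) v) (@Zideal C) _ s1
   (fun t => - term t) (fun t => - t.1.1%:~R + t.1.2%:~R * 2) 0).
- by move=> a v w; rewrite lieDr lieZr.
- split=> [|a v w vJ wJ]; first exact: rpred0.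
  by rewrite rpredD // -mulr_algl; exact: ZidealMl.
- by move=> v vJ; apply: rpredB; [exact: ZidealMl|exact: ZidealMr].
- rewrite scale0r lieDr lieNr; apply/eqP; rewrite subr_eq0; apply/eqP.
  transitivity (0 : U).
    by apply: lie_comm; case: (jcommutantP _ (valP u)).
  rewrite (big_morph (lie (jgenU C tH)) (lieDr _) (_ : _ = 0)); last first.
    by rewrite /lie mulr0 mul0r subrr.
  rewrite big_filter big1 // => t /eqP e2; apply: lie_comm.
  have := wterm t; rewrite e2 intrM mulrC addNr /jwt scale0r addr0; exact.
- move=> t; rewrite mem_filter => /andP [ne ts]; split.
    rewrite addrC subr_eq0 mulrC -(intrM _ 2) eqr_int eq_sym; exact: ne.
  rewrite lieNr scalerN /lie; congr (- _).
  by rewrite (wterm t) addrAC subrr add0r.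
have -> : val u - \sum_(t <- s0) term t + \sum_(t <- s1) - term t =
    val u - \sum_(t <- s) term t.
  rewrite sumrN -addrA -opprD !big_filter.
  by rewrite [in RHS](bigID (fun t => t.1.1 == 2 * t.1.2)).
apply/piAP.
by rewrite e rmorph_sum; apply: eq_bigr => t _; rewrite /= piterm.
Qed.
End Classes.

(** * Central and grading elements of D_k *)

Section ClassIdentities.
Variables (C : numClosedFieldType) (k : C).
Local Notation aHn := (piA (jHnu C)).

Lemma shift_pow (A : algType C) (x y : A) a n :
  x * y = y * (x + a%:A) -> x * y ^+ n = y ^+ n * (x + (a *+ n)%:A).
Proof.
move=> e; elim: n => [|n IH]; first by rewrite mulr0n scale0r addr0 mulr1 mul1r.
rewrite exprSr mulrA IH -mulrA mulrDl e mulr_algl -(mulr_algr _ y) -mulrDr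
  mulrA.
by rewrite -exprSr -addrA -scalerDl -mulrS.
Qed.

Lemma Hn_EF_pow q :
  aHn * piA (EF_pow C q) = piA (EF_pow C q) * (aHn + (q%:~R * 2)%:A).
Proof.
have ws := jA_split C; rewrite -absz_signr /EF_pow rmorphXn.
apply: shift_pow; case: ifP => _.
  by rewrite (ws_H_E ws) scaler_nat.
by rewrite (ws_H_F ws) scaleNr scaler_nat.
Qed.

(** Here cal E = H_nu - H in A, and H commutes with the translation by q. *)
Lemma piK_calE_ktrans q : piK (kcalE C * ktrans C q) =
  piK (ktrans C q * (kcalE C + (q%:~R * 2)%:A)).
Proof.
have [_ [He Hf]] := ws_comm (jA_split C).
have calE : piK (kcalE C) = aHn - piA (jgenU C tH).
  by rewrite piA_Hnu addrC addKr.
rewrite [LHS]rmorphM [RHS]rmorphM /= [piK (_ + _)]rmorphD /= linearZ /= rmorph1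
  calE.
rewrite mulrBl -addrA mulrDr [- _ + _]addrC mulrDr mulrN addrA.
have [Ht _] := jcommutantP _ (valP (ktrans C q)).
rewrite -(rmorphM (@piA C) (jgenU C tH)) Ht rmorphM -/(piK _); congr (_ - _).
rewrite -mulrDr piK_ktrans mulrA (fe_pow_comm (2 * q) He Hf) -!mulrA.
by rewrite Hn_EF_pow.
Qed.

Lemma piA_casimir_central u : GRing.comm (piA (jcasimir C)) (piA u).
Proof.
have [ce cf cE cF cH] := casimir_central (jA_split C).
have scal x a : GRing.comm x (a%:A : jA C).
  by rewrite /GRing.comm mulr_algl mulr_algr.
rewrite piA_casimir; apply: piA_ind; try exact: comm_lie.
- exact: scal.
- by move=> x y; exact: commrD.
- by move=> x y; exact: commrM.
have -> : piA (jgenU C tH) =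
    aHn - (piA (jgenU C tf) * piA (jgenU C te) + 2^-1%:A).
  by rewrite -piA_calE piA_Hnu addrK.
apply: commrB; first exact: comm_lie.
by apply: commrD => //; apply: commrM; exact: comm_lie.
Qed.

Lemma jD_casimir_central (d : jD k) : jD_casimir k * d = d * jD_casimir k.
Proof.
have [u ->] := cls_surj d; rewrite -/(cls k (kcasimir C)) -!rmorphM.
by apply: cls_eq; rewrite !rmorphM; exact: piA_casimir_central.
Qed.

Lemma jD_scalarM a (d : jD k) : jD_scalar k a * d = a *: d.
Proof.
by rewrite /jD_scalar -[LHS](@algquot_scaleAl _ _ (jDideal k)) mul1r.
Qed.

Lemma jD_scalarMr a (d : jD k) : d * jD_scalar k a = a *: d.
Proof.
by rewrite /jD_scalar -[LHS](@algquot_scaleAr _ _ (jDideal k)) mulr1.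
Qed.

Lemma jD_scalarC a (d : jD k) : jD_scalar k a * d = d * jD_scalar k a.
Proof. by rewrite jD_scalarM jD_scalarMr. Qed.

Lemma cls_scal a : cls k a%:A = jD_scalar k a.
Proof. by rewrite linearZ /= rmorph1. Qed.

Definition jtrans (q : int) : jD k := cls k (ktrans C q).

(** The class of H_nu, because H_nu = cal E + H in A and H = k in D_k. *)
Definition wt_op : jD k := jD_calE k + jD_scalar k k.

Lemma wt_op_jtrans q :
  wt_op * jtrans q = jtrans q * (wt_op + jD_scalar k (q%:~R * 2)).
Proof.
have := cls_eq k (piK_calE_ktrans q).
rewrite !rmorphM rmorphD /= cls_scal => e.
by rewrite mulrDl jD_scalarC -[jD_calE k]/(cls k (kcalE C)) e -mulrDr addrAC.
Qed.

End ClassIdentities.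

(** * The cyclic module generated by a weight vector *)

Section RestrictionOfScalars.
Variables (C : numClosedFieldType) (k : C) (W : lmodType (jD k)).

(** An alias that carries the complex scaling, so that linear algebra over C
applies to a D_k-module. *)
Definition resC : Type := W.
HB.instance Definition _ := GRing.Zmodule.on resC.

Definition resC_scale (a : C) (w : resC) : resC := jD_scalar k a *: (w : W).

Lemma resC_scaleA a b w : resC_scale a (resC_scale b w) = resC_scale (a * b) w.
Proof. by rewrite /resC_scale scalerA jD_scalarM /jD_scalar scalerA. Qed.
Lemma resC_scale1 : left_id 1 resC_scale.
Proof. by move=> w; rewrite /resC_scale /jD_scalar !scale1r. Qed.
Lemma resC_scaleDr : right_distributive resC_scale +%R.
Proof. by move=> a u v; exact: (scalerDr (jD_scalar k a) (u : W) v). Qed.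
Lemma resC_scaleDl w : {morph resC_scale^~ w : a b / a + b}.
Proof. by move=> a b; rewrite /resC_scale /jD_scalar !scalerDl. Qed.

HB.instance Definition _ := GRing.Zmodule_isLmodule.Build C resC
  resC_scaleA resC_scale1 resC_scaleDr resC_scaleDl.

Definition act (d : jD k) (w : resC) : resC := d *: (w : W).

Lemma act_linear d : linear (act d).
Proof.
move=> a u v; rewrite [LHS](scalerDr d (jD_scalar k a *: (u : W)) v).
by rewrite scalerA -jD_scalarC -scalerA.
Qed.
HB.instance Definition _ d := GRing.isLinear.Build C resC resC *:%R (act d)
  (act_linear d).

Lemma actM d d' w : act (d * d') w = act d (act d' w).
Proof. by rewrite /act scalerA. Qed.
Lemma act1 w : act 1 w = w.
Proof. exact: (scale1r (w : W)). Qed.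
Lemma actD d d' w : act (d + d') w = act d w + act d' w.
Proof. exact: (scalerDl (w : W)). Qed.
Lemma act_scalar a w : act (jD_scalar k a) w = a *: w.
Proof. by []. Qed.
Lemma act_sum I (s : seq I) (F : I -> jD k) w :
  act (\sum_(i <- s) F i) w = \sum_(i <- s) act (F i) w.
Proof. exact: (scaler_suml (w : W)). Qed.

Definition wt_char (l c : C) (v : resC) : Prop :=
  act (wt_op k) v = l *: v /\ act (jD_casimir k) v = c *: v.

Lemma diag_act l c b (v : resC) :
  diag b -> wt_char l c v -> exists a, act (cls k b) v = a *: v.
Proof.
move=> db [vl vc]; elim: db => [a||||u w _ [a ua] _ [b' wb]|u w _ [a ua] _
  [b' wb]].
- by exists a; rewrite cls_scal.
- by exists k; rewrite cls_H.
- exists (l - k); rewrite scalerBl -vl /wt_op actD act_scalar addrK.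
  by rewrite [cls k _](_ : _ = jD_calE k).
- by exists c.
- by exists (a + b'); rewrite rmorphD /= actD ua wb scalerDl.
- by exists (a * b'); rewrite rmorphM /= actM wb linearZ /= ua scalerA mulrC.
Qed.

Lemma jtrans_weight l q (v : resC) : act (wt_op k) v = l *: v ->
  act (wt_op k) (act (jtrans k q) v) = (l + q%:~R * 2) *: act (jtrans k q) v.
Proof.
move=> vl; rewrite -actM wt_op_jtrans actM actD vl act_scalar -scalerDl.
by rewrite linearZ.
Qed.

(** In [cls_spanned] the diagonal factors act on v by scalars; collecting equal
translations makes the weights of the terms distinct. *)
Lemma cyclic_sum l c (v : resC) d : wt_char l c v ->
  exists (r : seq int) (a : int -> C), uniq r /\
    act d v = \sum_(q <- r) a q *: act (jtrans k q) v.
Proof.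
move=> vlc; have [u ->] := cls_surj d; have [s ds ->] := cls_spanned k u.
have /choice [al alE] (t : int * jUk C) : exists a,
    t \in s -> act (cls k t.2) v = a *: v.
  case: (boolP (t \in s)) => [ts|_]; last by exists 0.
  by have [a e] := diag_act (ds t ts) vlc; exists a.
exists (undup (map fst s)), (fun q => \sum_(t <- s | t.1 == q) al t).
split; first exact: undup_uniq.
transitivity (\sum_(q <- undup (map fst s)) \sum_(t <- s | t.1 == q)
    al t *: act (jtrans k q) v); last first.
  by apply: eq_bigr => q _; rewrite scaler_suml.
rewrite (exchange_big_dep predT) //= act_sum big_seq [RHS]big_seq.
apply: eq_bigr => t ts; rewrite actM alE // linearZ /= -big_filter.
have -> : [seq q <- undup (map fst s) | t.1 == q] = [:: t.1].
  have := @filter_pred1_uniq _ (undup (map fst s)) t.1 (undup_uniq _).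
  rewrite mem_undup map_f // => /(_ isT) <-; apply: eq_filter => q.
  by rewrite /= eq_sym.
by rewrite big_seq1.
Qed.

End RestrictionOfScalars.

Section CyclicModules.
Variables (C : numClosedFieldType) (k : C) (W : lmodType (jD k)).
Variables (l c : C) (v : resC W).
Hypothesis vlc : wt_char l c v.
Local Notation tau q := (act (jtrans k q) v).

Lemma int_weight_inj (p q : int) : l + p%:~R * 2 = l + q%:~R * 2 -> p = q.
Proof.
by move/addrI/(mulIf (_ : 2 != 0 :> C)); rewrite pnatr_eq0 => /(_ isT)/intr_inj.
Qed.

Lemma tau_weight q : act (wt_op k) (tau q) = (l + q%:~R * 2) *: tau q.
Proof. by case: vlc => vl _; exact: jtrans_weight. Qed.

(** The terms of the sum have different weights, so each of them belongs to a
submodule that contains the sum. *)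
Lemma cyclic_component (S : {pred W}) r (a : int -> C) q :
  submod_closed S -> uniq r -> \sum_(p <- r) a p *: tau p \in S -> q \in r ->
  a q *: tau q \in S.
Proof.
move=> [S0 linS] ur sumS qr; move: sumS; rewrite (big_rem q) //=.
apply: (@eigen_separation C (resC W) (act (wt_op k)) S _ (rem q r)
  (fun p => a p *: tau p) (fun p => l + p%:~R * 2) (l + q%:~R * 2)).
- exact: act_linear.
- by split=> // b u w uS wS; exact: (linS (jD_scalar k b)).
- move=> w wS; rewrite -[act _ _]addr0; exact: linS.
- by rewrite linearZ /= tau_weight !scalerA mulrC.
move=> p; rewrite mem_rem_uniq // inE => /andP [pq _]; split.
  by apply: contra pq => /eqP /int_weight_inj ->.
by rewrite linearZ /= tau_weight !scalerA mulrC.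
Qed.

Lemma cyclic_weight_line mu d :
  act (wt_op k) (act d v) = mu *: act d v ->
  act d v = 0 \/ exists q a, mu = l + q%:~R * 2 /\ act d v = a *: tau q.
Proof.
have [r [a [ur e]]] := cyclic_sum d vlc; move=> dmu.
have sep (x : resC W) s : act (wt_op k) x = mu *: x ->
    {in s, forall p, l + p%:~R * 2 != mu} ->
    x = \sum_(p <- s) a p *: tau p -> x = 0.
  move=> xmu smu xE; apply/eqP.
  apply: (@eigen_separation C (resC W) (act (wt_op k)) (pred1 0) _ s
    (fun p => - (a p *: tau p)) (fun p => l + p%:~R * 2) mu x) => //.
  - exact: act_linear.
  - split; first by rewrite inE.
    by move=> b u w; rewrite !inE => /eqP -> /eqP ->; rewrite scaler0 addr0.
  - by move=> w; rewrite !inE => /eqP ->; rewrite linear0.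
  - move=> p ps; split; first exact: smu.
    by rewrite linearN linearZ /= tau_weight scalerN !scalerA mulrC.
  by rewrite sumrN -xE subrr inE.
case: (boolP (has (fun p => l + p%:~R * 2 == mu) r)) =>
  [/hasP [q qr /eqP qmu]|].
  right; exists q, (a q); split=> //; apply/eqP; rewrite -subr_eq0; apply/eqP.
  apply: (sep _ (rem q r)).
  - by rewrite linearB linearZ /= dmu tau_weight qmu scalerBr !scalerA mulrC.
  - move=> p; rewrite mem_rem_uniq // inE => /andP [pq _].
    by rewrite -qmu; apply: contra pq => /eqP /int_weight_inj ->.
  by rewrite e (big_rem q) //= addrAC subrr add0r.
move=> /hasPn nomu; left; exact: (sep _ r).
Qed.

Hypothesis v0 : v != 0.
Hypothesis gen : forall w, exists d, w = act d v.
(* By [cyclic_component] a nonzero submodule contains a nonzero t_q v, so v. *)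
Hypothesis ret : forall q, tau q != 0 -> exists d, act d (tau q) = v.

Lemma cyclic_irreducible : irreducible W.
Proof.
split; first by exists v.
move=> S subS; case: (boolP `[< forall w, w \in S -> w = 0 >]) =>
  [/asboolP|/asboolP nS].
  by left.
right; have [S0 linS] := subS.
have actS d w : w \in S -> act d w \in S.
  by move=> wS; rewrite -[act _ _]addr0; exact: linS.
suff vS : v \in S by move=> w; have [d ->] := gen w; exact: actS.
have [w wS w0] : exists2 w, w \in S & w <> 0.
  apply: contrapT => nex; apply: nS => w wS; apply: contrapT => w0.
  by apply: nex; exists w.
have [d we] := gen w; have [r [a [ur e]]] := cyclic_sum d vlc.
have [q qr aq0] : exists2 q, q \in r & a q *: tau q <> 0.
  apply: contrapT => nex; apply: w0; rewrite we e big_seq big1 // => q qr.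
  by apply: contrapT => aq; apply: nex; exists q.
rewrite we e in wS; have := cyclic_component subS ur wS qr.
have [aq tq] : a q != 0 /\ tau q != 0.
  by split; apply/eqP => z; apply: aq0; rewrite z ?scale0r ?scaler0.
have [d' d'v] := ret tq.
move=> /(actS (jD_scalar k (a q)^-1));
  rewrite act_scalar scalerA mulVf // scale1r.
by move=> /(actS d'); rewrite d'v.
Qed.

Lemma cyclic_weights : weights W =
  [set m | exists2 q, tau q != 0 & m = l + q%:~R * 2].
Proof.
apply/seteqP; split=> [m [w wm w0]|_ [q tq ->]].
  have [d we] := gen w; rewrite we in wm w0.
  have [z|[q [a [mE e]]]] := cyclic_weight_line wm.
    by move: w0; rewrite [_ == _](_ : _ = true) //; apply/eqP.
  exists q => //; apply/eqP => z; move: w0; rewrite e z scaler0.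
  by rewrite [_ == _](_ : _ = true) //; apply/eqP.
by exists (tau q) => //; exact: tau_weight.
Qed.

Lemma cyclic_central_character : has_central_character W c.
Proof.
move=> w; have [d ->] := gen w.
change (act (jD_casimir k) (act d v) = c *: act d v).
by rewrite -actM jD_casimir_central actM (proj2 vlc) linearZ.
Qed.

Lemma calE_eigen (w : resC W) a :
  eigen_space (jD_calE k) a w <-> act (wt_op k) w = (a + k) *: w.
Proof.
rewrite /wt_op actD act_scalar scalerDl; split=> [e|/addIr //].
by congr (_ + _).
Qed.

Lemma cyclic_admissible : admissible W.
Proof.
split=> [w|a].
  have [d ->] := gen w; have [r [b [ur e]]] := cyclic_sum d vlc.
  exists (map (fun q => b q *: tau q) r); split; last by rewrite big_map.
  move=> _ /mapP [q qr ->]; exists (l + q%:~R * 2 - k); apply/calE_eigen.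
  by rewrite subrK linearZ /= tau_weight !scalerA mulrC.
case: (pselect (exists q, a + k = l + q%:~R * 2)) => [[q aq]|nq].
  exists 1%N, (fun=> tau q); split=> [_|w /calE_eigen].
    by apply/calE_eigen; rewrite aq tau_weight.
  have [d ->] := gen w => /cyclic_weight_line [->|[q' [b [e ->]]]].
    by exists (fun=> 0); rewrite big_ord1 -/(act _ _) act_scalar scale0r.
  move: e; rewrite aq => /int_weight_inj ->.
  by exists (fun=> b); rewrite big_ord1.
exists 0%N, (fun=> v); split=> [[]//|w /calE_eigen].
have [d ->] := gen w => /cyclic_weight_line [->|[q [b [e _]]]].
  by exists (fun=> 0); rewrite big_ord0.
by case: nq; exists q.
Qed.

End CyclicModules.

(** * Eigenvectors of an operator on a finite-dimensional subspace *)

Section PolynomialEigenvector.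
Variables (C : closedFieldType) (V : lmodType C) (T : {linear V -> V}) (v : V).

Definition poly_act (p : {poly C}) : V := \sum_(i < size p) p`_i *: iter i T v.

Lemma poly_actE n (p : {poly C}) : (size p <= n)%N ->
  poly_act p = \sum_(i < n) p`_i *: iter i T v.
Proof.
move=> pn; rewrite /poly_act (big_ord_widen n (fun i => p`_i *: iter i T v) pn).
rewrite big_mkcond /=; apply: eq_bigr => i _;
  case: ltnP => // /(nth_default 0) ->.
by rewrite scale0r.
Qed.

Lemma poly_act_mulXsubC z p :
  poly_act (('X - z%:P) * p) = T (poly_act p) - z *: poly_act p.
Proof.
have sz : (size (('X - z%:P) * p)%R <= (size p).+1)%N.
  by apply: leq_trans (size_polyMleq _ _) _; rewrite size_XsubC.
rewrite (poly_actE sz) big_ord_recl /= [X in T X]/poly_act.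
have -> : poly_act p = p`_0 *: v + \sum_(i < size p) p`_i.+1 *: iter i.+1 T v.
  rewrite (poly_actE (leqnSn _)) big_ord_recl /=; congr (_ + _).
rewrite linear_sum scalerDr scaler_sumr opprD addrCA -sumrB.
rewrite mulrBl coefB coefXM coefCM /= sub0r scaleNr scalerA; congr (_ + _).
apply: eq_bigr => i _; rewrite coefB coefXM coefCM /= scalerBl
  [T (p`_i *: _)]linearZ /=.
by rewrite scalerA.
Qed.

(** If p(T) v = 0 with p split into linear factors, the first partial product
that kills v is T - z applied to a nonzero vector. *)
Lemma poly_act_eigenvector p : v != 0 -> p != 0 -> poly_act p = 0 ->
  exists w z, w != 0 /\ T w = z *: w.
Proof.
move=> v0 p0; have [r pE] := closed_field_poly_normal p; rewrite pE.
have -> q : poly_act (lead_coef p *: q) = lead_coef p *: poly_act q.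
  rewrite (poly_actE (size_scale_leq _ _)) /poly_act scaler_sumr.
  by apply: eq_bigr => i _; rewrite coefZ scalerA.
move=> /eqP; rewrite scaler_eq0 lead_coef_eq0 (negbTE p0) /= => /eqP.
elim: r {pE} => [|z r IH].
  rewrite big_nil /poly_act size_poly1 big_ord1 /= coef1 scale1r => v00.
  by rewrite v00 eqxx in v0.
rewrite big_cons poly_act_mulXsubC.
case: (eqVneq (poly_act (\prod_(z <- r) ('X - z%:P))) 0) => [/IH //|w0 /eqP].
by rewrite subr_eq0 => /eqP e; exists (poly_act (\prod_(z <- r) ('X - z%:P))),
  z.
Qed.

(** The n + 1 vectors v, T v, ..., T^n v lie in the span of n vectors, which
gives a nonzero polynomial p with p(T) v = 0. *)
Lemma finite_dim_eigenvector n (e : 'I_n -> V) :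
  (forall i, exists a : 'I_n -> C, iter i T v = \sum_j a j *: e j) -> v != 0 ->
  exists w z, w != 0 /\ T w = z *: w.
Proof.
move=> /choice [a aE] v0; pose M : 'M[C]_(n.+1, n) := \matrix_(i, j) a i j.
have /rowV0Pn [x /sub_kermxP xM x0] : kermx M != 0.
  rewrite -mxrank_eq0 mxrank_ker subn_eq0 -ltnNge ltnS; exact: rank_leq_col.
pose p := \poly_(i < n.+1) x 0 (inord i).
apply: (poly_act_eigenvector (p := p)) => //.
  apply: contra x0 => /eqP p0; apply/eqP/rowP => i.
  have := congr1 (fun q : {poly C} => q`_i) p0.
  by rewrite coef_poly ltn_ord inord_val coef0 mxE.
rewrite (poly_actE (size_poly _ _)).
transitivity (\sum_(j < n) (x *m M) 0 j *: e j); last first.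
  by rewrite xM big1 // => j _; rewrite mxE scale0r.
under [RHS]eq_bigr => j _ do rewrite mxE scaler_suml.
rewrite exchange_big /=; apply: eq_bigr => i _.
rewrite coef_poly ltn_ord inord_val aE scaler_sumr; apply: eq_bigr => j _.
by rewrite scalerA mxE.
Qed.
End PolynomialEigenvector.

(** * Central characters and the uniqueness of irreducible modules *)

Section Classification.
Variables (C : numClosedFieldType) (k : C).
Implicit Types W : lmodType (jD k).

Lemma irreducible_cyclic W (v w : W) : irreducible W -> v != 0 ->
  exists d, w = d *: v.
Proof.
move=> [_ irr] v0; pose S : {pred W} := fun w => `[< exists d, w = d *: v >].
have subS : submod_closed S.
  split=> [|a x y /asboolP [b ->] /asboolP [d ->]]; apply/asboolP.
    by exists 0; rewrite scale0r.
  by exists (a * b + d); rewrite scalerDl scalerA.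
case: (irr S subS) => [S0|Sw]; last by apply/asboolP/Sw.
suff /S0 vv : v \in S by rewrite vv eqxx in v0.
by apply/asboolP; exists 1; rewrite scale1r.
Qed.

Lemma exists_eigenvector W x : irreducible W -> acts_semisimply W x ->
  exists a (w : W), w != 0 /\ eigen_space x a w.
Proof.
move=> [[v v0] _] ss; have [s [sE vE]] := ss v.
have [w ws w0] : exists2 w, w \in s & w <> 0.
  apply: contrapT => nex; move: v0; rewrite vE big_seq big1 ?eqxx // => w ws.
  by apply: contrapT => w0; apply: nex; exists w.
by have [a wa] := sE w ws; exists a, w; split=> //; apply/eqP.
Qed.

Lemma exists_weight_vector W c : irreducible W -> acts_semisimply W
  (jD_calE k) ->
  has_central_character W c -> exists l (v : resC W), v != 0 /\ wt_char l c v.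
Proof.
move=> irr ss cc; have [a [w [w0 wa]]] := exists_eigenvector irr ss.
exists (a + k), (w : resC W); split=> //.
by split; [exact/calE_eigen|exact: cc].
Qed.

Lemma irreducible_central_character W :
  irreducible W -> admissible W -> exists c, has_central_character W c.
Proof.
move=> irrW [ss fd]; have [a [w [w0 wa]]] := exists_eigenvector irrW ss.
have [n [e [eE eP]]] := fd a.
have cw i : eigen_space (jD_calE k) a
  (iter i (act (jD_casimir k)) (w : resC W)).
  elim: i => //= i; set x := iter _ _ _ => xa.
  rewrite /eigen_space /mkset /act !scalerA -jD_casimir_central.
  by rewrite jD_scalarC -!scalerA; congr (_ *: _).
have [u [c [u0 uc]]] := finite_dim_eigenvector (T := act (jD_casimir k))
   (fun i => eP _ (cw i)) (w0 : (w : resC W) != 0).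
exists c => x; have [d ->] := irreducible_cyclic x irrW u0.
have ucW : jD_casimir k *: (u : W) = jD_scalar k c *: (u : W) by exact: uc.
by rewrite scalerA jD_casimir_central -scalerA ucW !scalerA jD_scalarC.
Qed.

Lemma jtrans0 : jtrans k 0 = 1.
Proof. by rewrite /jtrans /ktrans /= expr0 rmorph1. Qed.

(** The diagonal argument: if the ideal killing v did not kill v', then, W'
being irreducible, some element of it would send (v, v') to (0, v') in
W * W'; but the weight l part of the module generated by (v, v') is the line
through (v, v'). *)
Lemma annihilator_sub W W' l c (v : resC W) (v' : resC W') d :
  irreducible W' -> v != 0 -> wt_char l c v -> wt_char l c v' ->
  act d v = 0 -> act d v' = 0.
Proof.
move=> [_ irr] v0 [vl vc] [vl' vc'] dv.
pose S : {pred W'} := fun w => `[< exists2 d, act d v = 0 & act d v' = w >].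
have subS : submod_closed S.
  split=> [|a x y /asboolP [b bv <-] /asboolP [b' bv' <-]]; apply/asboolP.
    by exists 0; rewrite /act scale0r.
  exists (a * b + b'); last by rewrite actD actM.
  by rewrite actD actM bv bv' addr0 linear0.
case: (irr S subS) => [S0|/(_ v')].
  by apply: S0; apply/asboolP; exists d.
move=> /asboolP [b bv bv']; pose P : lmodType (jD k) := (W * W')%type.
pose vv : resC P := (v, v').
have vvlc : wt_char l c vv.
  by split; [congr (_, _); [exact: vl|exact: vl']|congr (_, _);
    [exact: vc|exact: vc']].
have bvv : act b vv = (0, v') by congr (_, _).
have : act (wt_op k) (act b vv) = l *: act b vv.
  rewrite bvv; congr (_, _); last exact: vl'.
  by rewrite !scaler0.
move=> /(cyclic_weight_line vvlc) [|[q [a [lq]]]]; rewrite bvv.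
  by move=> [->]; rewrite linear0.
have q0 : 0 = q by apply: (@int_weight_inj C l); rewrite -lq mul0r addr0.
rewrite -q0 jtrans0 act1 => -[av av'].
have /eqP : (a *: v : resC W) = 0 by [].
rewrite scaler_eq0 (negbTE v0) orbF => /eqP a0.
have -> : v' = a *: v' by exact: av'.
by rewrite a0 scale0r linear0.
Qed.

Lemma irreducible_equivalent W W' l c (v : resC W) (v' : resC W') :
  irreducible W -> irreducible W' -> v != 0 -> v' != 0 ->
  wt_char l c v -> wt_char l c v' -> equivalent W W'.
Proof.
move=> irr irr' v0 v0' vlc vlc'.
have /choice [D DE] : forall w : W, exists d, w = d *: (v : W).
  by move=> w; exact: irreducible_cyclic.
have /choice [D' DE'] : forall w : W', exists d, w = d *: (v' : W').
  by move=> w; exact: irreducible_cyclic.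
have eqv d d' : d *: (v : W) = d' *: (v : W) <-> d *: (v' : W') = d' *:
  (v' : W').
  split=> e; apply/eqP; rewrite -subr_eq0 -scalerBl; apply/eqP.
    apply: (annihilator_sub irr' v0 vlc vlc').
    by rewrite /act scalerBl e subrr.
  apply: (annihilator_sub irr v0' vlc' vlc).
  by rewrite /act scalerBl e subrr.
pose f (w : W) : W' := D w *: (v' : W').
have fl : linear f.
  move=> a x y; rewrite /f scalerA -scalerDl; apply/eqv.
  by rewrite -DE scalerDl -scalerA -!DE.
pose F : {linear W -> W'} := HB.pack f (GRing.isLinear.Build _ _ _ _ f fl).
exists F; exists (fun w => D' w *: (v : W)) => w.
  by rewrite [RHS]DE; apply/eqv; rewrite -DE'.
by rewrite [RHS]DE'; apply/eqv; rewrite -DE.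
Qed.

End Classification.

(** * The k-weight space as a module over D_k *)

Section WeightSpaceModule.
Variables (C : numClosedFieldType) (k c l : C).
Local Notation G := (int * int)%type.
Local Notation M := (fspace C G).
Local Notation phi := (weight_rep k c l).
Local Notation uH := (jgenU C tH).
Local Notation rP := (weight_jrep k c l).

Lemma wrep_linear : linear phi.
Proof. exact: jU_lift_linear rP. Qed.
HB.instance Definition _ := GRing.isLinear.Build C (jU C) (endo C G) *:%R phi
  wrep_linear.
Lemma wrep_monoid : monoid_morphism phi.
Proof. by split=> [|u v]; [exact: jU_lift1 rP|exact: (jU_liftM rP u v)]. Qed.
HB.instance Definition _ := GRing.isMonoidMorphism.Build (jU C) (endo C G) phi
  wrep_monoid.

Lemma wrepM u v x : phi (u * v) x = phi u (phi v x).
Proof. by rewrite (rmorphM phi). Qed.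
Lemma wrepD u v x : phi (u + v) x = phi u x + phi v x.
Proof. by rewrite [phi _](rmorphD phi). Qed.
Lemma wrepZ a u x : phi (a *: u) x = a *: phi u x.
Proof. by rewrite [phi _](linearZ_LR phi). Qed.
Lemma wrep1 x : phi 1 x = x.
Proof. by rewrite (rmorph1 phi). Qed.
Lemma wrep_addr u x y : phi u (x + y) = phi u x + phi u y.
Proof. exact: endo_addr. Qed.
Lemma wrep_scale u a x : phi u (a *: x) = a *: phi u x.
Proof. exact: endo_scale. Qed.
Lemma wrep_Z x : phi (jgenU C tZ) x = - (2^-1 *: x).
Proof. by rewrite [phi _](jU_lift_gen rP). Qed.

Definition kwt : {pred M} := fun x => `[< phi uH x = k *: x >].

Lemma wrep0 u : phi u 0 = 0.
Proof. by rewrite -(scale0r (0 : M)) wrep_scale !scale0r. Qed.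

Lemma kwt_zmod_closed : zmod_closed kwt.
Proof.
split=> [|x y /asboolP kx /asboolP ky]; apply/asboolP.
  by rewrite wrep0 scaler0.
by rewrite -scaleN1r wrep_addr wrep_scale kx ky scalerDr !scalerA mulrC.
Qed.
HB.instance Definition _ := GRing.isZmodClosed.Build M kwt kwt_zmod_closed.

Record kmod := KMod { kmod_val : M; _ : kmod_val \in kwt }.
HB.instance Definition _ := [isSub for kmod_val].
HB.instance Definition _ := [Choice of kmod by <:].
HB.instance Definition _ := [SubChoice_isSubZmodule of kmod by <:].

Fact kmod_act_key (u : jUk C) (x : kmod) : phi (val u) (val x) \in kwt.
Proof.
apply/asboolP; have [Hu _] := jcommutantP _ (valP u).
rewrite -wrepM Hu wrepM; have /asboolP -> := valP x.
by rewrite wrep_scale.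
Qed.

Definition kmod_act u x : kmod := KMod (kmod_act_key u x).

(** On the k-weight space both H - k and Z + 1/2 act by zero. *)
Lemma wrep_left_ideal u (x : kmod) : jleft_ideal k u -> phi u (val x) = 0.
Proof.
move=> [a [b ->]]; have /asboolP Hx := valP x.
rewrite wrepD !wrepM !wrepD wrep_Z wrepZ wrep1 addNr wrep0 addr0.
by rewrite -scaleN1r !wrepZ wrep1 Hx scaleN1r subrr wrep0.
Qed.

Definition kmod_scale (d : jD k) (x : kmod) : kmod :=
  kmod_act (repr (d : Quotient.quot (jDideal k))) x.

Lemma kmod_scaleE u x : kmod_scale (cls k u) x = kmod_act u x.
Proof.
apply/val_inj => /=; apply/eqP; rewrite -subr_eq0; apply/eqP.
set w := repr _; have : w - u \in jDideal k by exact: repr_algquot_pi.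
by move=> /asboolP /(wrep_left_ideal x); rewrite jUk_valB rmorphB.
Qed.

Lemma kmod_scaleA a b x : kmod_scale a (kmod_scale b x) = kmod_scale (a * b) x.
Proof.
have [u ->] := cls_surj a; have [v ->] := cls_surj b.
rewrite -rmorphM !kmod_scaleE; apply/val_inj => /=.
exact/esym/wrepM.
Qed.
Lemma kmod_scale1 : left_id 1 kmod_scale.
Proof.
move=> x; rewrite -[1](rmorph1 (cls k)) kmod_scaleE; apply/val_inj => /=.
exact: wrep1.
Qed.
Lemma kmod_scaleDr : right_distributive kmod_scale +%R.
Proof. by move=> d x y; apply/val_inj; exact: endo_addr. Qed.
Lemma kmod_scaleDl x : {morph kmod_scale^~ x : a b / a + b}.
Proof.
move=> a b; have [u ->] := cls_surj a; have [v ->] := cls_surj b.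
rewrite -rmorphD !kmod_scaleE; apply/val_inj => /=.
exact: wrepD.
Qed.

HB.instance Definition _ := GRing.Zmodule_isLmodule.Build (jD k) kmod
  kmod_scaleA kmod_scale1 kmod_scaleDr kmod_scaleDl.

Lemma kmod_cls u (x : kmod) :
  kmod_val (cls k u *: x) = phi (val u) (kmod_val x).
Proof. by rewrite [cls k u *: x]kmod_scaleE. Qed.

Lemma wrep_e x : phi (jgenU C te) x = op_e k l x.
Proof. by rewrite [phi _](jU_lift_gen rP). Qed.
Lemma wrep_f x : phi (jgenU C tf) x = op_f k l x.
Proof. by rewrite [phi _](jU_lift_gen rP). Qed.

Lemma wrep_Enu x : phi (jEnu C) x = op_E c l x.
Proof.
rewrite wrepD wrepZ expr2 wrepM !wrep_e [phi _](jU_lift_gen rP) /=.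
by rewrite -[RHS](subrK (2^-1 *: op_e k l (op_e k l x))).
Qed.

Lemma wrep_Fnu x : phi (jFnu C) x = op_F c l x.
Proof.
rewrite wrepD -scaleN1r !wrepZ scaleN1r expr2 wrepM !wrep_f.
rewrite [phi _](jU_lift_gen rP) /=.
by rewrite -[RHS](addrK (2^-1 *: op_f k l (op_f k l x))).
Qed.

Lemma wrep_H x :
  phi uH x = op_H l x - op_f k l (op_e k l x) - 2^-1 *: x.
Proof. by rewrite [phi _](jU_lift_gen rP). Qed.

Lemma wrep_Hnu x : phi (jHnu C) x = op_H l x.
Proof.
rewrite !wrepD wrepM wrep_e wrep_f wrepZ wrep1 wrep_H addrAC subrK.
by rewrite subrK.
Qed.

Lemma wshift_delta2 (a b n m : int) (w : G -> C) :
  wshift (a, b) w (fdelta C (n, m)) =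
    w (n - a, m - b) *: fdelta C (n - a, m - b).
Proof. exact: wshift_delta. Qed.

Lemma op_e_delta n m :
  op_e k l (fdelta C (n, m)) = xexp k l n *: fdelta C (n - 1, m).
Proof. by rewrite /op_e wshift_delta2 /= subr0 subrK. Qed.

Lemma op_f_delta n m :
  op_f k l (fdelta C (n, m)) = gate (xexp k l (n + 1)) *: fdelta C (n + 1, m).
Proof. by rewrite /op_f wshift_delta2 /= subr0 opprK. Qed.

Lemma op_E_delta n m :
  op_E c l (fdelta C (n, m)) = gate (sl2_coef c l m) *: fdelta C (n, m + 1).
Proof. by rewrite /op_E wshift_delta2 /= subr0 opprK addrK. Qed.

Lemma op_F_delta n m :
  op_F c l (fdelta C (n, m)) = sl2_coef c l (m - 1) *: fdelta C (n, m - 1).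
Proof. by rewrite /op_F wshift_delta2 /= subr0. Qed.

Lemma op_H_delta n m :
  op_H l (fdelta C (n, m)) = (l + 2 * m%:~R) *: fdelta C (n, m).
Proof. by rewrite /op_H wshift_delta subr0. Qed.

Lemma wrep_calE x : phi (jcalE C) x = op_H l x - phi uH x.
Proof.
have ef : op_e k l (op_f k l x) = op_f k l (op_e k l x) + x.
  have lx : lie (op_e k l) (op_f k l) x = x.
    by rewrite (ws_ef (weight_ops_rels k c l)).
  rewrite -[LHS](subrK (op_f k l (op_e k l x))) addrC.
  by congr (_ + _); exact: lx.
rewrite wrep_H -addrA -opprD subKr wrepZ wrepD !wrepM !wrep_e !wrep_f ef addrA.
by rewrite scalerDr half_double.
Qed.

Fact kdelta_key m : fdelta C (2 * m, m) \in kwt.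
Proof.
apply/asboolP; rewrite wrep_H op_H_delta op_e_delta endo_scale op_f_delta subrK.
rewrite scalerA [xexp _ _ _ * _]mulrC gate_mul -!scalerBl /xexp intrM;
  congr (_ *: _); ring.
Qed.

(** The basis vector of weight l + 2 m; the H-weight k forces the first
coordinate 2 m. *)
Definition kdelta (m : int) : kmod := KMod (kdelta_key m).

Lemma kmod_valZ a (x : resC kmod) : kmod_val (a *: x) = a *: kmod_val x.
Proof.
rewrite [a *: x](_ : _ = cls k a%:A *: (x : kmod)); last by rewrite cls_scal.
rewrite kmod_cls [val _](linearZ_LR (val : {linear jUk C -> jU C})) wrepZ.
by congr (_ *: _); exact: wrep1.
Qed.

Lemma act_cls u (x : resC kmod) :
  kmod_val (act (cls k u) x) = phi (val u) (kmod_val x).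
Proof. exact: kmod_cls. Qed.

Lemma kdelta_neq0 m : kdelta m != 0 :> resC kmod.
Proof.
apply/eqP => /(congr1 kmod_val) /(congr1 (fun x : M => x (2 * m, m))) /eqP.
by rewrite /= /fdelta eqxx oner_eq0.
Qed.

Definition raise_coef m : C :=
  gate (sl2_coef c l m) * gate (xexp k l (2 * m + 1)) * gate
    (xexp k l (2 * m + 1 + 1)).

Definition lower_coef m : C :=
  sl2_coef c l m * xexp k l (2 * m + 1 + 1) * xexp k l (2 * m + 1).

Lemma raise_kdelta m :
  act (cls k (kraise C)) (kdelta m) = raise_coef m *:
    (kdelta (m + 1) : resC kmod).
Proof.
apply/val_inj; rewrite [LHS]act_cls [RHS]kmod_valZ /= expr2 !wrepM wrep_Enu
  !wrep_f.
rewrite op_E_delta !endo_scale op_f_delta endo_scale op_f_delta !scalerA.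
by rewrite /raise_coef mulrDr -addrA.
Qed.

Lemma lower_kdelta m :
  act (cls k (klower C)) (kdelta (m + 1)) = lower_coef m *:
    (kdelta m : resC kmod).
Proof.
have e2 : 2 * (m + 1) = 2 * m + 1 + 1 by rewrite mulrDr -addrA.
apply/val_inj; rewrite [LHS]act_cls [RHS]kmod_valZ /= expr2 !wrepM wrep_Fnu
  !wrep_e.
rewrite op_F_delta !endo_scale op_e_delta endo_scale op_e_delta !scalerA.
by rewrite e2 !addrK.
Qed.

Lemma raise_lower_coef m : (raise_coef m == 0) = (lower_coef m == 0).
Proof.
have gate0 (a : C) : (gate a == 0) = (a == 0) by rewrite /gate pnatr_eq0 eqb0
  negbK.
rewrite /raise_coef /lower_coef; move: (sl2_coef _ _ _) (xexp _ _ _)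
  (xexp _ _ _).
by move=> s x y; rewrite !mulf_eq0 !gate0 orbAC.
Qed.

Lemma kdelta_wt_char m : wt_char (l + 2 * m%:~R) c (kdelta m : resC kmod).
Proof.
split; apply/val_inj; rewrite [RHS]kmod_valZ.
  rewrite /wt_op -(cls_scal k k) -[jD_calE k]/(cls k (kcalE C)) -rmorphD.
  rewrite [LHS]act_cls.
  rewrite [val _](_ : _ = jcalE C + k *: 1) // wrepD [phi (k *: 1) _]wrepZ
    wrep1.
  rewrite wrep_calE op_H_delta.
  by have /asboolP -> := kdelta_key m; rewrite subrK.
rewrite -[jD_casimir k]/(cls k (kcasimir C)) [LHS]act_cls /= /jcasimir.
rewrite !wrepD !wrepZ expr2 !wrepM !wrep_Hnu wrep_Enu wrep_Fnu op_H_delta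
  !endo_scale.
rewrite op_H_delta op_E_delta endo_scale op_F_delta addrK !scalerA -!scalerDl.
congr (_ *: _); rewrite -mulrA gate_mul /sl2_coef.
by field.
Qed.

End WeightSpaceModule.

(** * Submodules generated by one vector *)

Section CyclicSubmodule.
Variables (R : pzRingType) (W : lmodType R) (w : W).

Definition in_cyclic : {pred W} := fun x => `[< exists d, x = d *: w >].

Lemma in_cyclic_submod : submod_closed in_cyclic.
Proof.
split=> [|a x y /asboolP [b ->] /asboolP [d ->]]; apply/asboolP.
  by exists 0; rewrite scale0r.
by exists (a * b + d); rewrite scalerDl scalerA.
Qed.
HB.instance Definition _ := GRing.isSubmodClosed.Build R W in_cyclic
  in_cyclic_submod.

Record cyclic_sub := CyclicSub { cyclic_val : W; _ : cyclic_val \in in_cyclic }.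
HB.instance Definition _ := [isSub for cyclic_val].
HB.instance Definition _ := [Choice of cyclic_sub by <:].
HB.instance Definition _ := [SubChoice_isSubLmodule of cyclic_sub by <:].

Fact cyclic_gen_key : w \in in_cyclic.
Proof. by apply/asboolP; exists 1; rewrite scale1r. Qed.
Definition cyclic_gen : cyclic_sub := CyclicSub cyclic_gen_key.

Lemma cyclic_valZ d (x : cyclic_sub) : cyclic_val (d *: x) = d *: cyclic_val x.
Proof. exact: (linearZ_LR (val : {linear cyclic_sub -> W})). Qed.

Lemma cyclic_genP (x : cyclic_sub) : exists d, x = d *: cyclic_gen.
Proof.
have /asboolP [d e] := valP x; exists d; apply/val_inj.
by rewrite [RHS]cyclic_valZ.
Qed.
End CyclicSubmodule.

(** * Ladders *)

Section Ladder.
Variables (C : numClosedFieldType) (k : C) (W : lmodType (jD k)).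
Variables (A B : jD k) (D : nat -> resC W) (a b : nat -> C).
Hypothesis up : forall i, act A (D i) = a i *: D i.+1.
Hypothesis down : forall i, act B (D i.+1) = b i *: D i.
Hypothesis ab0 : forall i, (a i == 0) = (b i == 0).
Hypothesis D0 : forall i, D i != 0.

Lemma ladder_up n : act (A ^+ n) (D 0) = (\prod_(i < n) a i) *: D n.
Proof.
elim: n => [|n IH]; first by rewrite expr0 act1 big_ord0 scale1r.
by rewrite exprS actM IH linearZ /= up scalerA big_ord_recr.
Qed.

Lemma ladder_down n : act (B ^+ n) (D n) = (\prod_(i < n) b i) *: D 0.
Proof.
elim: n => [|n IH]; first by rewrite expr0 act1 big_ord0 scale1r.
by rewrite exprSr actM down linearZ /= IH scalerA big_ord_recr mulrC.
Qed.

Lemma ladder_neq0 n :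
  (act (A ^+ n) (D 0) != 0) <-> (forall i, (i < n)%N -> a i != 0).
Proof.
rewrite ladder_up scaler_eq0 (negbTE (D0 n)) orbF;
  split=> [/prodf_neq0 p i ltin|p].
  exact: (p (Ordinal ltin)).
by apply/prodf_neq0 => i _; exact: p.
Qed.

(** The coefficients of A and B vanish together, so if A^n does not kill D 0,
then B^n brings the image back. *)
Lemma ladder_return n : act (A ^+ n) (D 0) != 0 ->
  exists d, act d (act (A ^+ n) (D 0)) = D 0.
Proof.
move=> An; have an' := (ladder_neq0 n).1 An.
move: An; rewrite ladder_up scaler_eq0 negb_or => /andP [an _].
exists (jD_scalar k ((\prod_(i < n) a i) * \prod_(i < n) b i)^-1 * B ^+ n).
rewrite actM act_scalar linearZ /= ladder_down !scalerA -mulrA mulVf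
  ?scale1r //.
by rewrite mulf_neq0 //; apply/prodf_neq0 => i _; rewrite -ab0; exact: an'.
Qed.
End Ladder.

(** * The irreducible module with given central character and weight *)

Section Construction.
Variables (C : numClosedFieldType) (k c l : C).

Definition irrep : lmodType (jD k) := cyclic_sub (kdelta k c l 0).
Definition irrep_gen : resC irrep := cyclic_gen (kdelta k c l 0).

Lemma act_irrep_gen d : cyclic_val (act d irrep_gen) = act d (kdelta k c l 0).
Proof. exact: cyclic_valZ. Qed.

Lemma act_irrep_gen_eq0 d : (act d irrep_gen == 0) =
  (act d (kdelta k c l 0 : resC _) == 0).
Proof. by rewrite -act_irrep_gen. Qed.

Lemma irrep_gen_wt_char : wt_char l c irrep_gen.
Proof.
have [vl vc] := kdelta_wt_char k c l 0.
split; apply/val_inj; rewrite [LHS]act_irrep_gen [RHS]cyclic_valZ.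
  by rewrite vl mulr0 addr0.
by rewrite vc.
Qed.

Lemma kdelta_up (n : nat) : act (cls k (kraise C)) (kdelta k c l n : resC _) =
  raise_coef k c l n *: (kdelta k c l n.+1 : resC _).
Proof. by rewrite raise_kdelta intS addrC. Qed.

Lemma kdelta_up_inv (n : nat) : act (cls k (klower C))
  (kdelta k c l n.+1 : resC _) =
  lower_coef k c l n *: (kdelta k c l n : resC _).
Proof. by rewrite intS addrC lower_kdelta. Qed.

Lemma kdelta_down (n : nat) : act (cls k (klower C))
  (kdelta k c l (- n%:Z) : resC _) =
  lower_coef k c l (- n.+1%:Z) *: (kdelta k c l (- n.+1%:Z) : resC _).
Proof. by rewrite -lower_kdelta intS opprD addrAC addNr add0r. Qed.

Lemma kdelta_down_inv (n : nat) : act (cls k (kraise C))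
  (kdelta k c l (- n.+1%:Z) : resC _) =
  raise_coef k c l (- n.+1%:Z) *: (kdelta k c l (- n%:Z) : resC _).
Proof. by rewrite raise_kdelta intS opprD addrAC addNr add0r. Qed.

(** No zero lies between l and l + 2 q.  The second clause bears on q < 0, where
the step from l - 2 i to l - 2 (i + 1) has the coefficient of index -(i + 1). *)
Definition unobstructed (q : int) : Prop :=
  (forall i : nat, (i%:Z < q) -> lower_coef k c l i != 0) /\
  (forall i : nat, (q <= - i.+1%:Z) -> lower_coef k c l (- i.+1%:Z) != 0).

Lemma jtrans_irrep_gen q :
  (act (jtrans k q) irrep_gen != 0 <-> unobstructed q) /\
  (act (jtrans k q) irrep_gen != 0 -> exists d, act d
    (act (jtrans k q) irrep_gen) = irrep_gen).
Proof.
have ret d : (exists d', act d' (act d (kdelta k c l 0 : resC _)) = kdelta k c l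
  0) ->
    exists d', act d' (act d irrep_gen) = irrep_gen.
  move=> [d' e]; exists d'; rewrite -actM; apply/val_inj.
  by rewrite [LHS]act_irrep_gen actM.
have dn := @kdelta_neq0 C k c l.
have rl := @raise_lower_coef C k c l.
rewrite act_irrep_gen_eq0 /jtrans /ktrans rmorphXn; case: q => n /=.
  have N := ladder_neq0 kdelta_up (fun i => dn i) n.
  split; last first.
    by move=> ?; apply: ret;
      exact: (ladder_return kdelta_up kdelta_up_inv (fun i => rl i)
        (fun i => dn i)).
  split=> [/N p|[p _]]; last by apply/N => i ltin; rewrite rl; exact: p.
  by split=> i ltin; [rewrite -rl; exact: p|lia].
have N := ladder_neq0 kdelta_down (fun i => dn (- i%:Z)) n.+1.
split; last first.
  move=> ?; apply: ret.
  exact: (ladder_return kdelta_down kdelta_down_inv (fun i => esym (rl _))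
    (fun i => dn (- i%:Z))).
split=> [/N p|[_ p]]; last by apply/N => i ltin; apply: p; lia.
by split=> i ltin; [lia|apply: p; lia].
Qed.

Lemma irrep_props : [/\ irreducible irrep, admissible irrep,
  has_central_character irrep c &
  weights irrep = [set m | exists2 q, unobstructed q & m = l + q%:~R * 2]].
Proof.
have gen w : exists d, w = act d irrep_gen by exact: cyclic_genP.
have ret q := (jtrans_irrep_gen q).2.
have v0 : irrep_gen != 0.
  by have := act_irrep_gen_eq0 1; rewrite !act1 => ->; exact: kdelta_neq0.
split.
- exact: (cyclic_irreducible irrep_gen_wt_char).
- exact: (cyclic_admissible irrep_gen_wt_char).
- exact: (cyclic_central_character irrep_gen_wt_char).
rewrite (cyclic_weights irrep_gen_wt_char gen); apply/seteqP.
by split=> _ [q /(jtrans_irrep_gen q).1 tq ->]; exists q.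
Qed.

End Construction.

(** * The interval Delta *)

Section WeightSets.
Variables (C : numClosedFieldType) (l : C).

Lemma ext_le_trans (x y z : ext C) : ext_le x y -> ext_le y z -> ext_le x z.
Proof.
case: x y z => [|a|] [|b|] [|d|] //= [m ->] [n ->].
by exists (m + n)%N; rewrite natrD mulrDr addrA.
Qed.

Lemma ext_le_fin (p q : int) :
  ext_le (fin (l + 2 * p%:~R)) (fin (l + 2 * q%:~R)) <-> p <= q.
Proof.
split=> [[n]|pq].
  rewrite -addrA -mulrDr -[n%:R]/(n%:Z%:~R) -intrD => /addrI /(mulfI _) e.
  have /intr_inj -> : q%:~R = (p + n)%:~R :> C by apply: e; rewrite pnatr_eq0.
  by rewrite lerDl.
exists `|q - p|%N; rewrite -addrA -mulrDr; congr (_ + _ * _).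
by rewrite -[_%:R]/(`|q - p|%N%:Z%:~R) gez0_abs ?subr_ge0 // -intrD [p + _]addrC
  subrK.
Qed.

Variable Z : set C.

(** The elements of the set lie in one coset, on which the order is total; the
maximum is attained at the least n, or is minus infinity. *)
Lemma ext_max_le (q : int) :
  ext_le (ext_max ([set ninfty] `|`
      [set fin m | m in Z `&` [set l - 2 * n%:R | n in [set: nat]]]))
    (fin (l + 2 * q%:~R)) <->
  forall n : nat, Z (l - 2 * n%:R) -> - n%:Z <= q.
Proof.
set M := [set ninfty] `|` _.
have minE n : l - 2 * n%:R = l + 2 * (- n%:Z)%:~R by rewrite mulrNz mulrN.
have MP n : Z (l - 2 * n%:R) -> M (fin (l - 2 * n%:R)).
  by move=> Zn; right; exists (l - 2 * n%:R) => //; split=> //; exists n.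
have exmax : exists m, M m /\ forall m', M m' -> ext_le m' m.
  case: (pselect (exists n : nat, `[< Z (l - 2 * n%:R) >])) => [ex|nex].
    case: (ex_minnP ex) => n /asboolP Zn minn.
    exists (fin (l - 2 * n%:R)); split; first exact: MP.
    move=> m' [->//|[x [Zm [m _ e]] <-]]; rewrite -e !minE; apply/ext_le_fin.
    by rewrite lerN2 lez_nat; apply: minn; apply/asboolP; rewrite e.
  exists ninfty; split=> [|m' [->//|[x [Zm [m _ e]] _]]]; first by left.
  by case: nex; exists m; apply/asboolP; rewrite e.
have [Mm maxm] := xgetPex ninfty exmax; rewrite -/(ext_max M) in Mm maxm *.
split=> [le n Zn|H].
  have := ext_le_trans (maxm _ (MP n Zn)) le.
  by rewrite minE; move/ext_le_fin.
case: Mm => [->//|[x [Zm [n _ e]] <-]].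
by rewrite -e minE; apply/ext_le_fin; apply: H; rewrite e.
Qed.

Lemma ext_min_le (q : int) :
  ext_le (fin (l + 2 * q%:~R)) (ext_min ([set pinfty] `|`
      [set fin m | m in Z `&` [set l + 2 * n%:R | n in [set: nat]]])) <->
  forall n : nat, Z (l + 2 * n%:R) -> q <= n%:Z.
Proof.
set M := [set pinfty] `|` _.
have MP n : Z (l + 2 * n%:R) -> M (fin (l + 2 * n%:R)).
  by move=> Zn; right; exists (l + 2 * n%:R) => //; split=> //; exists n.
have exmin : exists m, M m /\ forall m', M m' -> ext_le m m'.
  case: (pselect (exists n : nat, `[< Z (l + 2 * n%:R) >])) => [ex|nex].
    case: (ex_minnP ex) => n /asboolP Zn minn.
    exists (fin (l + 2 * n%:R)); split; first exact: MP.
    move=> m' [->//|[x [Zm [m _ e]] <-]]; rewrite -e; apply/(ext_le_fin n m).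
    by rewrite lez_nat; apply: minn; apply/asboolP; rewrite e.
  exists pinfty; split=> [|m' [->//|[x [Zm [m _ e]] _]]]; first by left.
  by case: nex; exists m; apply/asboolP; rewrite e.
have [Mm minm] := xgetPex pinfty exmin; rewrite -/(ext_min M) in Mm minm *.
split=> [le n Zn|H].
  have := ext_le_trans le (minm _ (MP n Zn)).
  by move/(ext_le_fin q n).
case: Mm => [->//|[x [Zm [n _ e]] <-]].
by rewrite -e; apply/(ext_le_fin q n); apply: H; rewrite e.
Qed.

End WeightSets.

Section DeltaDescription.
Variables (C : numClosedFieldType) (k c l : C).

(** Both bounds of Delta come from the zeros m of one function: the numbers
l + 2 m are the candidates for the upper bound, the numbers l + 2 (m + 1)
those for the lower bound. *)
Lemma lower_coef_eq0 m : (lower_coef k c l m == 0) =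
  [|| l + 2 * m%:~R == k - 2^-1, l + 2 * m%:~R == k - 3 / 2,
      l + 2 * m%:~R == - 1 + sqrtC (c + 1)
    | l + 2 * m%:~R == - 1 - sqrtC (c + 1)].
Proof.
set x := l + _.
have -> : lower_coef k c l m = (x - (k - 2^-1)) * (x - (k - 3 / 2)) *
    ((x - (- 1 + sqrtC (c + 1))) * (x - (- 1 - sqrtC (c + 1)))) * (- 4^-1).
  have s2 := sqrtCK (c + 1); set s := sqrtC _ in s2 *.
  rewrite /lower_coef /sl2_coef /xexp -s2 !intrD intrM -/x.
  by rewrite /x; field.
by rewrite !mulf_eq0 oppr_eq0 invr_eq0 pnatr_eq0 orbF !subr_eq0 -!orbA.
Qed.

Lemma upper_zero_lower_coef m :
  [set k - 2^-1; k - 3 / 2; - 1 + sqrtC (c + 1); - 1 - sqrtC (c + 1)]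
    (l + 2 * m%:~R) <-> lower_coef k c l m = 0.
Proof.
rewrite (rwP eqP) lower_coef_eq0 /mkset /=; split.
  by move=> [[[->|->]|->]|->]; rewrite eqxx ?orbT.
by move=> /or4P [] /eqP ->; [left; left; left|left; left; right|left;
  right|right].
Qed.

Lemma lower_zero_lower_coef m :
  [set k + 2^-1; k + 3 / 2; 1 + sqrtC (c + 1); 1 - sqrtC (c + 1)]
    (l + 2 * (m + 1)%:~R) <-> lower_coef k c l m = 0.
Proof.
rewrite (rwP eqP) lower_coef_eq0 /mkset /=.
have -> : l + 2 * (m + 1)%:~R = l + 2 * m%:~R + 2 by rewrite intrD mulrDr mulr1
  addrA.
have sh (x a b : C) : b = a + 2 -> (x + 2 = b) <-> (x == a).
  by move=> ->; split=> [/addIr ->|/eqP ->].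
have e1 : k + 3 / 2 = k - 2^-1 + 2 by field.
have e2 : k + 2^-1 = k - 3 / 2 + 2 by field.
have e3 : 1 + sqrtC (c + 1) = - 1 + sqrtC (c + 1) + 2 by ring.
have e4 : 1 - sqrtC (c + 1) = - 1 - sqrtC (c + 1) + 2 by ring.
split.
  move=> [[[/(sh _ _ _ e2)|/(sh _ _ _ e1)]|/(sh _ _ _ e3)]|/(sh _ _ _ e4)] ->;
  by rewrite ?orbT.
move=> /or4P [/(sh _ _ _ e1)|/(sh _ _ _ e2)|/(sh _ _ _ e3)|/(sh _ _ _ e4)] xE.
- by left; left; right.
- by left; left; left.
- by left; right.
- by right.
Qed.

Lemma DeltaE : Delta k c l = [set m | exists2 q, unobstructed k c l q & m = l +
  q%:~R * 2].
Proof.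
have minE n : l - 2 * n%:R = l + 2 * (- n.+1%:Z + 1)%:~R.
  by rewrite intS opprD addrAC addNr add0r mulrNz mulrN.
apply/seteqP; split=> m.
  move=> [[q ->] /ext_max_le lo /ext_min_le hi]; exists q;
    last by rewrite mulrC.
  split=> i qi; apply/eqP.
    by move=> /(upper_zero_lower_coef i) /hi; lia.
  by move=> /lower_zero_lower_coef; rewrite -minE => /lo; lia.
move=> [q [hi lo] ->]; rewrite [q%:~R * 2]mulrC; split; first by exists q.
  apply/ext_max_le => n; rewrite minE => /lower_zero_lower_coef z.
  by case: (lerP (- n%:Z) q) => // qn; have := lo n; rewrite z eqxx; lia.
apply/ext_min_le => n /(upper_zero_lower_coef n) z.
by case: (lerP q n%:Z) => // qn; have := hi n qn; rewrite z eqxx.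
Qed.

End DeltaDescription.

(** * The classification *)

Section Equivalence.
Variables (C : numClosedFieldType) (k : C).
Implicit Types W : lmodType (jD k).

Lemma equivalent_central_character W W' c :
  equivalent W W' -> has_central_character W c -> has_central_character W' c.
Proof.
move=> [f [g fK gK]] cc w; rewrite -[w]gK.
by rewrite -!linearZ_LR cc.
Qed.

Lemma equivalent_sym W W' : equivalent W W' -> equivalent W' W.
Proof.
move=> [f [g fK gK]].
have gl : linear g.
  by move=> a x y; apply: (can_inj fK); rewrite linearP !gK.
pose F : {linear W' -> W} := HB.pack g (GRing.isLinear.Build _ _ _ _ g gl).
by exists F; exists f.
Qed.

Lemma equivalent_weights W W' : equivalent W W' -> weights W `<=` weights W'.
Proof.
move=> [f fb] l [v vl v0]; exists (f v).
  by rewrite /weight_space /eigen_space /mkset -!linearZ_LR vl.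
by rewrite -(linear0 f) (inj_eq (bij_inj fb)).
Qed.

Lemma central_character_unique W c c' : irreducible W ->
  has_central_character W c -> has_central_character W c' -> c = c'.
Proof.
move=> [[v v0] _] cc cc'; apply/eqP; rewrite -subr_eq0.
have : (c - c') *: (v : resC W) == 0.
  by rewrite scalerBl subr_eq0; apply/eqP; exact: etrans (esym (cc v)) (cc' v).
by rewrite scaler_eq0 (negbTE (v0 : (v : resC W) != 0)) orbF.
Qed.

Lemma common_weight_equivalent W W' c l : irreducible W -> irreducible W' ->
  has_central_character W c -> has_central_character W' c ->
  weights W l -> weights W' l -> equivalent W W'.
Proof.
move=> irr irr' cc cc' [v vl v0] [v' vl' v0'].
apply: (@irreducible_equivalent _ _ _ _ l c (v : resC W) (v' : resC W')) => //.
  by split; [exact: vl|exact: cc].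
by split; [exact: vl'|exact: cc'].
Qed.

End Equivalence.

Theorem theorem6p6 (R : realType) (k : R[i]) :
  (* central character and weights are complete invariants *)
  (forall W : lmodType (jD k), irreducible W -> admissible W ->
     exists c, has_central_character W c) /\
  (forall W W' : lmodType (jD k),
     irreducible W -> admissible W -> irreducible W' -> admissible W' ->
     (equivalent W W' <->
      (forall c, has_central_character W c <-> has_central_character W' c) /\
      weights W = weights W')) /\
  exists V : R[i] -> R[i] -> lmodType (jD k),
    [/\ (* i *)
        forall c l, [/\ irreducible (V c l), admissible (V c l),
                        has_central_character (V c l) c &
                        weights (V c l) = Delta k c l],
        (* ii *)
        forall c l c' l',
          equivalent (V c l) (V c' l') <-> c' = c /\ Delta k c l l' &
        (* iii *)
        forall W : lmodType (jD k), irreducible W -> admissible W ->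
          exists c l, equivalent W (V c l)].
Proof.
have weq (W W' : lmodType (jD k)) : equivalent W W' -> weights W = weights W'.
  move=> e; apply/seteqP; split; apply: equivalent_weights => //.
  exact: equivalent_sym.
have exw (W : lmodType (jD k)) c : irreducible W -> admissible W ->
    has_central_character W c -> exists l, weights W l.
  move=> irr [ss _] cc; have [l [v [v0 [vl _]]]] := exists_weight_vector irr ss
    cc.
  by exists l, v.
have VP c l : [/\ irreducible (irrep k c l), admissible (irrep k c l),
    has_central_character (irrep k c l) c & weights (irrep k c l) = Delta k c
      l].
  by have [? ? ? ->] := irrep_props k c l; rewrite DeltaE.
have Dl c l : Delta k c l l.
  have [irr adm cc <-] := VP c l; exists (irrep_gen k c l).
    exact: (irrep_gen_wt_char k c l).1.
  by have := @act_irrep_gen_eq0 _ k c l 1; rewrite !act1 => ->;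
    exact: kdelta_neq0.
split; first by move=> W; exact: irreducible_central_character.
split.
  move=> W W' irr adm irr' adm'; split=> [e|[ce we]].
    split; last exact: weq.
    move=> c; split; first exact: equivalent_central_character.
    exact/equivalent_central_character/equivalent_sym.
  have [c cc] := irreducible_central_character irr adm.
  have [l wl] := exw _ _ irr adm cc.
  by apply: (common_weight_equivalent irr irr' cc ((ce c).1 cc) wl);
    rewrite -we.
exists (irrep k); split=> // [c l c' l'|W irr adm].
  have [irr adm cc wt] := VP c l; have [irr' adm' cc' wt'] := VP c' l'.
  split=> [e|[c'c dl]].
    split; last by rewrite -wt (weq _ _ e) wt'; exact: Dl.
    apply: (central_character_unique irr') => //.
    exact: equivalent_central_character e cc.
  apply: (common_weight_equivalent (l := l') irr irr' cc);
    first by rewrite -c'c.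
    by rewrite wt.
  by rewrite wt'; exact: Dl.
have [c cc] := irreducible_central_character irr adm.
have [l wl] := exw _ _ irr adm cc; exists c, l.
have [irr' _ cc' wt'] := VP c l.
by apply: (common_weight_equivalent irr irr' cc cc' wl); rewrite wt'; exact: Dl.
Qed.
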